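(* The following is provable in $\mathsf{RCA}_0$: every infinite Hausdorff CSC space has an infinite discrete subspace.
   Context: A countable second-countable (CSC) space (formalized in second-order arithmetic) is a tuple $\langle X,\mathcal{U},k\rangle$ where $X\subseteq\mathbb{N}$; $\mathcal{U}=\langle U_n:n\in\mathbb{N}\rangle$ is a sequence of subsets of $X$ such that every $x\in X$ belongs to some $U_n$; and $k:X\times\mathbb{N}\times\mathbb{N}\to\mathbb{N}$ is such that whenever $x\in U_m\cap U_n$ we have $x\in U_{k(x,m,n)}\subseteq U_m\cap U_n$. Write $U\in\mathcal{U}$ if $U=U_n$ for some $n$. It is infinite if $X$ is infinite; it is Hausdorff if for all $x\ne y$ in $X$ there are $U,V\in\mathcal{U}$ with $x\in U$, $y\in V$, $U\cap V=\emptyset$; it is discrete if $\{x\}\in\mathcal{U}$ for every $x\in X$. For $Y\subseteq X$, the subspace $Y$ is the CSC space $\langle Y,\langle U_n\cap Y:n\in\mathbb{N}\rangle,k\rangle$. *)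

(* Defs.v *)
From Stdlib Require Import List.
Import ListNotations.

(** * The language of second-order arithmetic

Two-sorted first-order logic.  Variables are de Bruijn indices, counted
separately for each sort: a number quantifier does not shift set indices, and
a set quantifier does not shift number indices.  The only set terms are set
variables, and there is no equality symbol for sets. *)

Inductive term : Type :=
| Var (n : nat)
| Zero
| One
| Add (s t : term)
| Mul (s t : term).

Inductive form : Type :=
| Bot
| Imp (A B : form)
| Eq (s t : term)
| Lt (s t : term)
| Mem (t : term) (X : nat)
| AllN (A : form)
| AllS (A : form).

(** The remaining connectives are the usual classical abbreviations. *)
Definition Neg (A : form) : form := Imp A Bot.
Definition And (A B : form) : form := Neg (Imp A (Neg B)).
Definition Or (A B : form) : form := Imp (Neg A) B.
Definition Iff (A B : form) : form := And (Imp A B) (Imp B A).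
Definition ExN (A : form) : form := Neg (AllN (Neg A)).
Definition ExS (A : form) : form := Neg (AllS (Neg A)).

Declare Scope term_scope.
Delimit Scope term_scope with term.
Bind Scope term_scope with term.
Declare Scope form_scope.
Delimit Scope form_scope with form.
Bind Scope form_scope with form.

Notation "$ n" := (Var n) (at level 1, n at level 0, format "$ n")
  : term_scope.
Notation "0" := Zero : term_scope.
Notation "1" := One : term_scope.
Notation "s + t" := (Add s t) : term_scope.
Notation "s * t" := (Mul s t) : term_scope.

Notation "s == t" := (Eq s t) (at level 70, no associativity) : form_scope.
Notation "s < t" := (Lt s t) : form_scope.
Notation "t ∈ X" := (Mem t X) (at level 70, no associativity) : form_scope.
Notation "~ A" := (Neg A) : form_scope.
Notation "A /\ B" := (And A B) : form_scope.
Notation "A \/ B" := (Or A B) : form_scope.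
Notation "A ==> B" := (Imp A B) (at level 90, right associativity)
  : form_scope.
Notation "A <==> B" := (Iff A B) (at level 95, no associativity) : form_scope.

(** ** Simultaneous substitution of terms for number variables and renaming of
    set variables *)

Fixpoint tsubst (sigma : nat -> term) (t : term) : term :=
  match t with
  | Var n => sigma n
  | Zero => Zero
  | One => One
  | Add s t => Add (tsubst sigma s) (tsubst sigma t)
  | Mul s t => Mul (tsubst sigma s) (tsubst sigma t)
  end.

Definition scons {T : Type} (x : T) (f : nat -> T) (n : nat) : T :=
  match n with O => x | S m => f m end.

Definition tshift (t : term) : term := tsubst (fun n => Var (S n)) t.
Definition upN (sigma : nat -> term) : nat -> term :=
  scons (Var O) (fun n => tshift (sigma n)).
Definition upS (rho : nat -> nat) : nat -> nat :=
  scons O (fun n => S (rho n)).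

Fixpoint subst (sigma : nat -> term) (rho : nat -> nat) (A : form) : form :=
  match A with
  | Bot => Bot
  | Imp A B => Imp (subst sigma rho A) (subst sigma rho B)
  | Eq s t => Eq (tsubst sigma s) (tsubst sigma t)
  | Lt s t => Lt (tsubst sigma s) (tsubst sigma t)
  | Mem t X => Mem (tsubst sigma t) (rho X)
  | AllN A => AllN (subst (upN sigma) rho A)
  | AllS A => AllS (subst sigma (upS rho) A)
  end.

Definition shiftN (A : form) : form :=
  subst (fun n => Var (S n)) (fun X => X) A.
Definition shiftS (A : form) : form := subst Var S A.
Definition instN (t : term) (A : form) : form :=
  subst (scons t Var) (fun X => X) A.
Definition instS (Y : nat) (A : form) : form :=
  subst Var (scons Y (fun X => X)) A.

(** * Derivability: classical two-sorted natural deduction with equality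

Axioms of [T] may be used in any context, so their free variables can be
generalized: a formula of [T] stands for its universal closure. *)

Inductive prv (T : form -> Prop) : list form -> form -> Prop :=
| prv_ax G A : T A -> prv T G A
| prv_hyp G A : In A G -> prv T G A
| prv_impI G A B : prv T (A :: G) B -> prv T G (Imp A B)
| prv_impE G A B : prv T G (Imp A B) -> prv T G A -> prv T G B
| prv_raa G A : prv T (Neg A :: G) Bot -> prv T G A
| prv_allNI G A : prv T (map shiftN G) A -> prv T G (AllN A)
| prv_allNE G A t : prv T G (AllN A) -> prv T G (instN t A)
| prv_allSI G A : prv T (map shiftS G) A -> prv T G (AllS A)
| prv_allSE G A Y : prv T G (AllS A) -> prv T G (instS Y A)
| prv_refl G t : prv T G (Eq t t)
| prv_leibniz G s t A :
    prv T G (Eq s t) -> prv T G (instN s A) -> prv T G (instN t A).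

Definition provable (T : form -> Prop) (A : form) : Prop := prv T [] A.

(** * The theory RCA0 *)

Inductive Sigma00 : form -> Prop :=
| Sigma00_bot : Sigma00 Bot
| Sigma00_eq s t : Sigma00 (s == t)
| Sigma00_lt s t : Sigma00 (s < t)
| Sigma00_mem t X : Sigma00 (t ∈ X)
| Sigma00_imp A B : Sigma00 A -> Sigma00 B -> Sigma00 (A ==> B)
| Sigma00_ball t A : Sigma00 A -> Sigma00 (AllN ($0 < tshift t ==> A))
| Sigma00_bex t A : Sigma00 A -> Sigma00 (ExN ($0 < tshift t /\ A)).

Inductive Sigma01 : form -> Prop :=
| Sigma01_ex A : Sigma00 A -> Sigma01 (ExN A).

Inductive Pi01 : form -> Prop :=
| Pi01_all A : Sigma00 A -> Pi01 (AllN A).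

(** In the two schemes number variable 0 is the induction, resp. comprehension,
    variable; all other free variables of the formulas are parameters. *)
Definition inst_succ (A : form) : form :=
  subst (scons ($0 + 1)%term (fun n => Var (S n))) (fun X => X) A.

Inductive RCA0 : form -> Prop :=
| succ_neq_zero : RCA0 (AllN (~ $0 + 1 == 0))
| succ_inj : RCA0 (AllN (AllN ($1 + 1 == $0 + 1 ==> $1 == $0)))
| add_zero : RCA0 (AllN ($0 + 0 == $0))
| add_succ : RCA0 (AllN (AllN ($1 + ($0 + 1) == ($1 + $0) + 1)))
| mul_zero : RCA0 (AllN ($0 * 0 == 0))
| mul_succ : RCA0 (AllN (AllN ($1 * ($0 + 1) == $1 * $0 + $1)))
| not_lt_zero : RCA0 (AllN (~ $0 < 0))
| lt_succ :
    RCA0 (AllN (AllN ($1 < $0 + 1 <==> $1 < $0 \/ $1 == $0)))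
| Sigma01_induction A : Sigma01 A ->
    RCA0 (instN 0 A /\ AllN (A ==> inst_succ A) ==> AllN A)
| Delta01_comprehension A B : Sigma01 A -> Pi01 B ->
    RCA0 (AllN (A <==> B) ==> ExS (AllN ($0 ∈ O <==> shiftS A))).

(** * CSC spaces in second-order arithmetic

Set arguments of the formulas below are set variables, given by their index.
Pairs are coded by (i, j) = (i + j)^2 + i and triples are nested to the left.
A sequence of sets U is coded by the set of pairs (x, n) with x in U_n.  The
function k is coded by its graph, the set of all ((x, m, n), p) with
k(x, m, n) = p. *)

Definition pair (s t : term) : term := ((s + t) * (s + t) + s)%term.

Definition graph_pt (x m n p : term) : term := pair (pair (pair x m) n) p.

Definition MemSeq (x : term) (U : nat) (n : term) : form := pair x n ∈ U.

Definition SubsetSeq (X U : nat) : form :=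
  AllN (AllN (MemSeq ($0) U ($1) ==> $0 ∈ X)).

Definition Covers (X U : nat) : form :=
  AllN ($0 ∈ X ==> ExN (MemSeq ($1) U ($0))).

(** In the second conjunct the quantified variables are x, m, n. *)
Definition IsFun (X k : nat) : form :=
  AllN ($0 ∈ k ==>
    ExN (ExN (ExN (ExN ($3 ∈ X /\ $4 == graph_pt ($3) ($2) ($1) ($0)))))) /\
  AllN (AllN (AllN ($2 ∈ X ==>
    ExN (graph_pt ($3) ($2) ($1) ($0) ∈ k) /\
    AllN (AllN (graph_pt ($4) ($3) ($2) ($1) ∈ k /\
                graph_pt ($4) ($3) ($2) ($0) ∈ k ==> $1 == $0))))).

(** The quantified variables are x, m, n, p = k(x, m, n), then a point of U_p. *)
Definition Refines (U k : nat) : form :=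
  AllN (AllN (AllN (AllN (
    graph_pt ($3) ($2) ($1) ($0) ∈ k /\
    MemSeq ($3) U ($2) /\ MemSeq ($3) U ($1) ==>
    MemSeq ($3) U ($0) /\
    AllN (MemSeq ($0) U ($1) ==>
          MemSeq ($0) U ($3) /\ MemSeq ($0) U ($2)))))).

Definition CSC (X U k : nat) : form :=
  SubsetSeq X U /\ Covers X U /\ IsFun X k /\ Refines U k.

Definition Infinite (X : nat) : form :=
  AllN (ExN ($1 < $0 /\ $0 ∈ X)).

(** The quantified variables are the points x, y, then the indices m, n of their
    neighbourhoods, then a common point. *)
Definition Hausdorff (X U : nat) : form :=
  AllN (AllN ($1 ∈ X /\ $0 ∈ X /\ ~ $1 == $0 ==>
    ExN (ExN (MemSeq ($3) U ($1) /\ MemSeq ($2) U ($0) /\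
      ~ ExN (MemSeq ($0) U ($2) /\ MemSeq ($0) U ($1)))))).

Definition Discrete (X U : nat) : form :=
  AllN ($0 ∈ X ==> ExN (AllN (MemSeq ($0) U ($1) <==> $0 == $2))).

(** The subspace Y of X carries the sequence V of the sets V_n = U_n ∩ Y and the
    restriction l of k to Y x N x N. *)
Definition Subspace (Y V l X U k : nat) : form :=
  AllN ($0 ∈ Y ==> $0 ∈ X) /\
  AllN (AllN (MemSeq ($0) V ($1) <==> MemSeq ($0) U ($1) /\ $0 ∈ Y)) /\
  AllN ($0 ∈ l <==> $0 ∈ k /\
    ExN (ExN (ExN (ExN ($3 ∈ Y /\ $4 == graph_pt ($3) ($2) ($1) ($0)))))).

(* Main.v *)
(** By completeness it suffices to argue in an arbitrary model of RCA0.  If every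
    point of X is isolated, take Y = X.  Otherwise let x be a limit point, and for
    z <> x let g(z) be the least j such that U_j contains x but not z; it exists by
    the Hausdorff property.  Let Y consist of the records of g, i.e. the z with
    g(y) < g(z) for all y < z.  As g is unbounded, Y is infinite, and it converges
    to x.  A point y of Y therefore has a basic neighbourhood, disjoint from one of
    x, that contains only boundedly many points of Y, and these can be separated
    from y one at a time.  That g is unbounded means that x has a basic
    neighbourhood inside the intersection of all U_j, j < n, that contain x.  Stated
    directly this is a Sigma_2 induction; one gets it from Sigma_1 induction by
    iterating k along a coded finite sequence. *)

From Stdlib Require Import List Arith Lia Ring Classical ClassicalEpsilon
  FunctionalExtensionality PropExtensionality Cantor.
Require Import Defs.
Import ListNotations.

(** * Substitution *)

(** The metatheory is classical with choice, so inside a model one may reason by cases freely, for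
    instance on whether a limit point exists. What is restricted is the complexity of the predicates
    fed to induction and comprehension, and this dictates the form of most statements about models:
    quantifiers are bounded wherever possible, and [Delta0] tracks this semantically. Two points are
    delicate. An inclusion of U_w in U_v is Pi_1, so asserting some U_w inside others is Sigma_2.
    That w is a value of [k] is atomic, though, and implies the inclusions. Sigma_1 induction
    therefore builds only a coded run of [k]; the inclusions are read off afterwards, for one point
    z at a time, by Delta_0 induction along the fixed code. The set of records must be Delta_1. The
    inequality g(y) < n is written as the existence of some i < n with x in U_i and y not in U_i,
    which is bounded; and since g(z) is unique, it can be introduced by either quantifier. The
    language has only sum and product, so the run of [k] is coded by divisibility, as in Gödel's
    beta function. *)

Lemma tsubst_comp sigma tau t :
  tsubst sigma (tsubst tau t) = tsubst (fun n => tsubst sigma (tau n)) t.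
Proof. induction t; simpl; congruence. Qed.

Lemma tsubst_id t : tsubst Var t = t.
Proof. induction t; simpl; congruence. Qed.

Lemma tsubst_scons_tshift s sigma t :
  tsubst (scons s sigma) (tshift t) = tsubst sigma t.
Proof. unfold tshift; rewrite tsubst_comp; reflexivity. Qed.

Lemma tsubst_upN_tshift sigma t :
  tsubst (upN sigma) (tshift t) = tshift (tsubst sigma t).
Proof. unfold tshift; rewrite !tsubst_comp; reflexivity. Qed.

Lemma scons_eta {T : Type} (f : nat -> T) : scons (f O) (fun n => f (S n)) = f.
Proof. apply functional_extensionality; now intros [|n]. Qed.

Lemma upN_comp sigma tau :
  (fun n => tsubst (upN sigma) (upN tau n)) =
  upN (fun n => tsubst sigma (tau n)).
Proof.
  apply functional_extensionality; intros [|n]; simpl; [reflexivity|].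
  apply tsubst_upN_tshift.
Qed.

Lemma upS_comp (rho pi : nat -> nat) :
  (fun n => upS rho (upS pi n)) = upS (fun n => rho (pi n)).
Proof. now apply functional_extensionality; intros [|n]. Qed.

Lemma subst_comp A : forall sigma rho tau pi,
  subst sigma rho (subst tau pi A) =
  subst (fun n => tsubst sigma (tau n)) (fun n => rho (pi n)) A.
Proof.
  induction A; intros; simpl; rewrite ?tsubst_comp; f_equal; auto.
  - now rewrite IHA, upN_comp.
  - now rewrite IHA, upS_comp.
Qed.

Lemma subst_id A : subst Var (fun X => X) A = A.
Proof.
  induction A; simpl; rewrite ?tsubst_id; f_equal; auto.
  - rewrite <- IHA at 2. f_equal. exact (scons_eta Var).
  - rewrite <- IHA at 2. f_equal. exact (scons_eta (fun X => X)).
Qed.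

Lemma subst_instN sigma rho t A :
  subst sigma rho (instN t A) =
  instN (tsubst sigma t) (subst (upN sigma) rho A).
Proof.
  unfold instN; rewrite !subst_comp; f_equal.
  apply functional_extensionality; intros [|n]; simpl; [reflexivity|].
  now rewrite tsubst_scons_tshift, tsubst_id.
Qed.

Lemma subst_instS sigma rho Y A :
  subst sigma rho (instS Y A) = instS (rho Y) (subst sigma (upS rho) A).
Proof.
  unfold instS; rewrite !subst_comp; f_equal.
  - apply functional_extensionality; intros n; simpl. now rewrite tsubst_id.
  - now apply functional_extensionality; intros [|n].
Qed.

Lemma subst_shiftN sigma rho A :
  subst (upN sigma) rho (shiftN A) = shiftN (subst sigma rho A).
Proof. unfold shiftN; rewrite !subst_comp; reflexivity. Qed.

Lemma subst_shiftS sigma rho A :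
  subst sigma (upS rho) (shiftS A) = shiftS (subst sigma rho A).
Proof.
  unfold shiftS; rewrite !subst_comp; f_equal.
  apply functional_extensionality; intros n; simpl. now rewrite tsubst_id.
Qed.

Lemma subst_inst_succ sigma rho A :
  subst (upN sigma) rho (inst_succ A) = inst_succ (subst (upN sigma) rho A).
Proof.
  unfold inst_succ; rewrite !subst_comp; f_equal.
  apply functional_extensionality; intros [|n]; simpl; [reflexivity|].
  now rewrite tsubst_scons_tshift.
Qed.

(** Substitution into a derivation also acts on the axioms used in it, so the theory itself has to
    be stable. *)
Definition subst_closed (T : form -> Prop) : Prop :=
  forall sigma rho A, T A -> T (subst sigma rho A).

Lemma Sigma00_subst A : Sigma00 A -> forall sigma rho,
  Sigma00 (subst sigma rho A).
Proof.
  induction 1; intros sigma rho; simpl; try (constructor; auto; fail).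
  - rewrite tsubst_upN_tshift. constructor; auto.
  - rewrite tsubst_upN_tshift.
    apply (Sigma00_bex (tsubst sigma t) (subst (upN sigma) rho A)); auto.
Qed.

(** Under the quantifier of the induction or comprehension variable a substitution becomes
    [upN sigma], which fixes variable 0 and so maps each instance of a scheme to another
    instance. *)
Lemma RCA0_subst : subst_closed RCA0.
Proof.
  intros sigma rho A []; try (constructor; fail).
  - pose proof (Sigma01_induction (subst (upN sigma) rho A0)) as E.
    rewrite <- subst_inst_succ in E.
    change Zero with (tsubst sigma Zero) in E.
    rewrite <- subst_instN in E. apply E.
    destruct H as [B HB]. exact (Sigma01_ex _ (Sigma00_subst _ HB _ _)).
  - pose proof (Delta01_comprehension (subst (upN sigma) rho A0)
                  (subst (upN sigma) rho B)) as E.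
    rewrite <- subst_shiftS in E. apply E.
    + destruct H as [C HC]. exact (Sigma01_ex _ (Sigma00_subst _ HC _ _)).
    + destruct H0 as [C HC]. exact (Pi01_all _ (Sigma00_subst _ HC _ _)).
Qed.

(** * Bounds on free variables *)

Fixpoint tbound (t : term) : nat :=
  match t with
  | Var n => S n
  | Zero | One => O
  | Add s t | Mul s t => Nat.max (tbound s) (tbound t)
  end.

Fixpoint Nbound (A : form) : nat :=
  match A with
  | Bot => O
  | Imp A B => Nat.max (Nbound A) (Nbound B)
  | Eq s t | Lt s t => Nat.max (tbound s) (tbound t)
  | Mem t X => tbound t
  | AllN A => pred (Nbound A)
  | AllS A => Nbound A
  end.

Fixpoint Sbound (A : form) : nat :=
  match A with
  | Bot | Eq _ _ | Lt _ _ => O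
  | Imp A B => Nat.max (Sbound A) (Sbound B)
  | Mem t X => S X
  | AllN A => Sbound A
  | AllS A => pred (Sbound A)
  end.

Lemma tsubst_ext t sigma tau :
  (forall n, n < tbound t -> sigma n = tau n) -> tsubst sigma t = tsubst tau t.
Proof.
  induction t; simpl; intros H; auto.
  - rewrite IHt1, IHt2; auto; intros; apply H; lia.
  - rewrite IHt1, IHt2; auto; intros; apply H; lia.
Qed.

Lemma subst_ext A : forall sigma tau rho pi,
  (forall n, n < Nbound A -> sigma n = tau n) ->
  (forall X, X < Sbound A -> rho X = pi X) ->
  subst sigma rho A = subst tau pi A.
Proof.
  induction A; simpl; intros sigma tau rho pi H K; f_equal;
    try (apply tsubst_ext; intros; apply H; lia); auto.
  - apply IHA1; intros; [apply H|apply K]; lia.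
  - apply IHA2; intros; [apply H|apply K]; lia.
  - apply IHA; auto. intros [|n] ?; simpl; [reflexivity|].
    rewrite H; [reflexivity|lia].
  - apply IHA; auto. intros [|n] ?; simpl; [reflexivity|].
    rewrite K; [reflexivity|lia].
Qed.

(** * Completeness *)

Lemma prv_weaken T G A : prv T G A -> forall G', incl G G' -> prv T G' A.
Proof.
  induction 1; intros G' I.
  - now apply prv_ax.
  - apply prv_hyp; auto.
  - apply prv_impI, IHprv. firstorder.
  - eapply prv_impE; auto.
  - apply prv_raa, IHprv. firstorder.
  - apply prv_allNI, IHprv. now apply incl_map.
  - apply prv_allNE; auto.
  - apply prv_allSI, IHprv. now apply incl_map.
  - apply prv_allSE; auto.
  - apply prv_refl.
  - eapply prv_leibniz; eauto.
Qed.

Lemma prv_subst T : subst_closed T -> forall G A, prv T G A ->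
  forall sigma rho, prv T (map (subst sigma rho) G) (subst sigma rho A).
Proof.
  intros HT G A H; induction H; intros sigma rho; simpl in *.
  - apply prv_ax, HT, H.
  - apply prv_hyp, in_map, H.
  - apply prv_impI, IHprv.
  - eapply prv_impE; eauto.
  - apply prv_raa, IHprv.
  - apply prv_allNI. specialize (IHprv (upN sigma) rho).
    rewrite map_map in *. erewrite map_ext; [exact IHprv|].
    intros; symmetry; apply subst_shiftN.
  - rewrite subst_instN. apply prv_allNE, IHprv.
  - apply prv_allSI. specialize (IHprv sigma (upS rho)).
    rewrite map_map in *. erewrite map_ext; [exact IHprv|].
    intros; symmetry; apply subst_shiftS.
  - rewrite subst_instS. apply prv_allSE, IHprv.
  - apply prv_refl.
  - rewrite subst_instN in *. eapply prv_leibniz; [apply IHprv1|].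
    rewrite <- subst_instN. apply IHprv2.
Qed.

Lemma list_bound {T : Type} (f : T -> nat) (l : list T) :
  exists b, forall x, In x l -> f x <= b.
Proof.
  induction l as [|y l [b Hb]]; [now exists O|].
  exists (Nat.max (f y) b). intros x [<-|Hx]; [lia|]. specialize (Hb x Hx). lia.
Qed.

(** The index [b] is free neither in [G] nor in [A]. Mapping it to 0 and shifting all others turns a
    derivation of the instance into one of [A] from the shifted context. *)
Lemma prv_AllN_of_fresh T G A : subst_closed T ->
  exists x, prv T G (instN (Var x) A) -> prv T G (AllN A).
Proof.
  intros HT. destruct (list_bound Nbound (A :: G)) as [b Hb].
  exists b. intros H. apply prv_allNI.
  apply (prv_subst _ HT) with (rho := fun X => X)
    (sigma := fun n => if n =? b then Var O else Var (S n)) in H.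
  replace (map shiftN G) with
    (map (subst (fun n => if n =? b then Var O else Var (S n)) (fun X => X)) G).
  - rewrite subst_instN in H. simpl in H. rewrite Nat.eqb_refl in H.
    unfold instN in H. rewrite subst_comp in H.
    erewrite subst_ext with (A := A) in H; [rewrite subst_id in H; exact H| |auto].
    intros [|n] Hn; simpl; [reflexivity|].
    specialize (Hb A (or_introl eq_refl)).
    destruct (Nat.eqb_spec n b); [lia|reflexivity].
  - apply map_ext_in. intros B HB. apply subst_ext; auto.
    intros n Hn. specialize (Hb B (or_intror HB)).
    destruct (Nat.eqb_spec n b); [lia|reflexivity].
Qed.

Lemma prv_AllS_of_fresh T G A : subst_closed T ->
  exists Y, prv T G (instS Y A) -> prv T G (AllS A).
Proof.
  intros HT. destruct (list_bound Sbound (A :: G)) as [b Hb].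
  exists b. intros H. apply prv_allSI.
  apply (prv_subst _ HT) with (sigma := Var)
    (rho := fun n => if n =? b then O else S n) in H.
  replace (map shiftS G) with
    (map (subst Var (fun n => if n =? b then O else S n)) G).
  - rewrite subst_instS in H. rewrite Nat.eqb_refl in H.
    unfold instS in H. rewrite subst_comp in H.
    erewrite subst_ext with (A := A) in H; [rewrite subst_id in H; exact H|auto|].
    intros [|n] Hn; simpl; [reflexivity|].
    specialize (Hb A (or_introl eq_refl)).
    destruct (Nat.eqb_spec n b); [lia|reflexivity].
  - apply map_ext_in. intros B HB. apply subst_ext; auto.
    intros n Hn. specialize (Hb B (or_intror HB)).
    destruct (Nat.eqb_spec n b); [lia|reflexivity].
Qed.

(** * Enumeration of all formulas *)

Fixpoint decode_term (fuel c : nat) : term :=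
  match fuel with
  | O => Zero
  | S f =>
    let (tag, r) := of_nat c in
    let (a, b) := of_nat r in
    match tag with
    | 0 => Var r
    | 1 => Zero
    | 2 => One
    | 3 => Add (decode_term f a) (decode_term f b)
    | _ => Mul (decode_term f a) (decode_term f b)
    end
  end.

Fixpoint decode_form (fuel c : nat) : form :=
  match fuel with
  | O => Bot
  | S f =>
    let (tag, r) := of_nat c in
    let (a, b) := of_nat r in
    match tag with
    | 0 => Bot
    | 1 => Imp (decode_form f a) (decode_form f b)
    | 2 => Eq (decode_term f a) (decode_term f b)
    | 3 => Lt (decode_term f a) (decode_term f b)
    | 4 => Mem (decode_term f a) b
    | 5 => AllN (decode_form f a)
    | _ => AllS (decode_form f a)
    end
  end.

(** Demanding the result for all larger fuel lets the fuels of two subterms be added in the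
    induction. *)
Lemma decode_term_surj t :
  exists c f, forall f', f <= f' -> decode_term f' c = t.
Proof.
  assert (K : forall tag a b f (s : term),
    (forall f', f <= f' -> decode_term (S f') (to_nat (tag, to_nat (a, b))) = s) ->
    exists c f, forall f', f <= f' -> decode_term f' c = s).
  { intros tag a b f s H. exists (to_nat (tag, to_nat (a, b))), (S f).
    intros [|f'] Hf; [lia|]. apply H. lia. }
  induction t as [n| | |s [a [f Ha]] t [b [g Hb]]|s [a [f Ha]] t [b [g Hb]]].
  (* A variable is read from the undivided payload, so [n] is presented as the code of its own
     components. *)
  - apply (K 0 (fst (of_nat n)) (snd (of_nat n)) 0). intros f' _. cbn [decode_term].
    rewrite !cancel_of_to, <- surjective_pairing, cancel_to_of.
    now destruct (of_nat n).
  - apply (K 1 0 0 0). intros f' _. cbn [decode_term]. now rewrite !cancel_of_to.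
  - apply (K 2 0 0 0). intros f' _. cbn [decode_term]. now rewrite !cancel_of_to.
  - apply (K 3 a b (f + g)). intros f' Hf. cbn [decode_term].
    rewrite !cancel_of_to, Ha, Hb; [reflexivity|lia|lia].
  - apply (K 4 a b (f + g)). intros f' Hf. cbn [decode_term].
    rewrite !cancel_of_to, Ha, Hb; [reflexivity|lia|lia].
Qed.

Lemma decode_form_surj A :
  exists c f, forall f', f <= f' -> decode_form f' c = A.
Proof.
  assert (K : forall tag a b f B,
    (forall f', f <= f' -> decode_form (S f') (to_nat (tag, to_nat (a, b))) = B) ->
    exists c f, forall f', f <= f' -> decode_form f' c = B).
  { intros tag a b f s H. exists (to_nat (tag, to_nat (a, b))), (S f).
    intros [|f'] Hf; [lia|]. apply H. lia. }
  induction A as [|A [a [f Ha]] B [b [g Hb]]|s t|s t|t X|A [a [f Ha]]|A [a [f Ha]]].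
  - apply (K 0 0 0 0). intros f' _. cbn [decode_form]. now rewrite !cancel_of_to.
  - apply (K 1 a b (f + g)). intros f' Hf. cbn [decode_form].
    rewrite !cancel_of_to, Ha, Hb; [reflexivity|lia|lia].
  - destruct (decode_term_surj s) as [a [f Ha]], (decode_term_surj t) as [b [g Hb]].
    apply (K 2 a b (f + g)). intros f' Hf. cbn [decode_form].
    rewrite !cancel_of_to, Ha, Hb; [reflexivity|lia|lia].
  - destruct (decode_term_surj s) as [a [f Ha]], (decode_term_surj t) as [b [g Hb]].
    apply (K 3 a b (f + g)). intros f' Hf. cbn [decode_form].
    rewrite !cancel_of_to, Ha, Hb; [reflexivity|lia|lia].
  - destruct (decode_term_surj t) as [a [f Ha]].
    apply (K 4 a X f). intros f' Hf. cbn [decode_form].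
    rewrite !cancel_of_to, Ha; [reflexivity|lia].
  - apply (K 5 a 0 f). intros f' Hf. cbn [decode_form].
    rewrite !cancel_of_to, Ha; [reflexivity|lia].
  - apply (K 6 a 0 f). intros f' Hf. cbn [decode_form].
    rewrite !cancel_of_to, Ha; [reflexivity|lia].
Qed.

Definition form_enum (n : nat) : form :=
  let (f, c) := of_nat n in decode_form f c.

Lemma form_enum_surj A : exists n, form_enum n = A.
Proof.
  destruct (decode_form_surj A) as [c [f H]].
  exists (to_nat (f, c)). unfold form_enum. rewrite cancel_of_to. auto.
Qed.

(** * Structures and satisfaction *)

Record structure := {
  num : Type;
  sets : Type;
  zero : num;
  one : num;
  add : num -> num -> num;
  mul : num -> num -> num;
  lt : num -> num -> Prop;
  mem : num -> sets -> Prop }.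

Fixpoint eval (M : structure) (e : nat -> num M) (t : term) : num M :=
  match t with
  | Var n => e n
  | Zero => zero M
  | One => one M
  | Add s t => add M (eval M e s) (eval M e t)
  | Mul s t => mul M (eval M e s) (eval M e t)
  end.

Fixpoint sat (M : structure) (e : nat -> num M) (s : nat -> sets M) (A : form)
  : Prop :=
  match A with
  | Bot => False
  | Imp A B => sat M e s A -> sat M e s B
  | Eq t u => eval M e t = eval M e u
  | Lt t u => lt M (eval M e t) (eval M e u)
  | Mem t X => mem M (eval M e t) (s X)
  | AllN A => forall d, sat M (scons d e) s A
  | AllS A => forall Z, sat M e (scons Z s) A
  end.

Definition models (M : structure) (T : form -> Prop) : Prop :=
  forall A, T A -> forall e s, sat M e s A.

(** * The Henkin model of a consistent context *)

Section Henkin.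

Context (T : form -> Prop) (T_subst : subst_closed T).

Definition consistent (G : list form) : Prop := ~ prv T G Bot.

Lemma consistent_Neg_witness G A x :
  In (Neg A) G -> (prv T G x -> prv T G A) ->
  consistent G -> consistent (Neg x :: G).
Proof.
  intros HA K C H. apply C. apply prv_impE with A; [now apply prv_hyp|].
  apply K. now apply prv_raa.
Qed.

(** Variables serve as Henkin constants: contexts are finite lists, so at every stage a fresh
    variable remains to witness a negated universal formula. *)
Lemma Henkin_step G A : consistent G ->
  exists G', consistent G' /\ incl G G' /\ (In A G' \/ In (Neg A) G') /\
    (forall B, A = Neg (AllN B) -> In A G' ->
       exists t, In (Neg (instN t B)) G') /\
    (forall B, A = Neg (AllS B) -> In A G' ->
       exists Y, In (Neg (instS Y B)) G').
Proof.
  intros C. destruct (classic (consistent (A :: G))) as [CA|NA].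
  - destruct (classic (exists B, A = Neg (AllN B))) as [[B ->]|N1].
    { destruct (prv_AllN_of_fresh T (Neg (AllN B) :: G) B T_subst) as [x Hx].
      exists (Neg (instN (Var x) B) :: Neg (AllN B) :: G). repeat split.
      - apply (consistent_Neg_witness _ (AllN B)); simpl; auto.
      - intros D HD; simpl; auto.
      - simpl; auto.
      - intros B' E _. injection E as <-. exists (Var x). simpl; auto.
      - discriminate. }
    destruct (classic (exists B, A = Neg (AllS B))) as [[B ->]|N2].
    { destruct (prv_AllS_of_fresh T (Neg (AllS B) :: G) B T_subst) as [x Hx].
      exists (Neg (instS x B) :: Neg (AllS B) :: G). repeat split.
      - apply (consistent_Neg_witness _ (AllS B)); simpl; auto.
      - intros D HD; simpl; auto.
      - simpl; auto.
      - discriminate.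
      - intros B' E _. injection E as <-. exists x. simpl; auto. }
    exists (A :: G). repeat split; auto using incl_tl, incl_refl.
    + simpl; auto.
    + intros B ->. now destruct N1; exists B.
    + intros B ->. now destruct N2; exists B.
  - apply NNPP in NA.
    assert (CN : consistent (Neg A :: G)).
    { intros H. apply C. apply prv_impE with A; [now apply prv_impI|].
      now apply prv_raa. }
    exists (Neg A :: G).
    (* When [A] is rejected, this makes both witness clauses vacuous. *)
    assert (I : ~ In A (Neg A :: G)).
    { intros I. apply CN. apply prv_impE with A; apply prv_hyp; simpl; auto. }
    repeat split; auto using incl_tl, incl_refl.
    + simpl; auto.
    + now intros.
    + now intros.
Qed.

Context (G0 : list form) (G0_consistent : consistent G0).

Definition Henkin_next (n : nat) (G : {G | consistent G}) : {G | consistent G} :=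
  let H := constructive_indefinite_description _
             (Henkin_step (proj1_sig G) (form_enum n) (proj2_sig G)) in
  exist _ (proj1_sig H) (proj1 (proj2_sig H)).

Fixpoint Henkin_chain (n : nat) : {G | consistent G} :=
  match n with
  | O => exist _ G0 G0_consistent
  | S n => Henkin_next n (Henkin_chain n)
  end.

Definition chain (n : nat) : list form := proj1_sig (Henkin_chain n).

Lemma chain_S n :
  incl (chain n) (chain (S n)) /\
  (In (form_enum n) (chain (S n)) \/ In (Neg (form_enum n)) (chain (S n))) /\
  (forall B, form_enum n = Neg (AllN B) -> In (form_enum n) (chain (S n)) ->
     exists t, In (Neg (instN t B)) (chain (S n))) /\
  (forall B, form_enum n = Neg (AllS B) -> In (form_enum n) (chain (S n)) ->
     exists Y, In (Neg (instS Y B)) (chain (S n))).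
Proof.
  unfold chain; simpl; unfold Henkin_next; simpl.
  destruct (constructive_indefinite_description _ _) as [G' H]. simpl. tauto.
Qed.

Lemma chain_incl m n : m <= n -> incl (chain m) (chain n).
Proof.
  induction 1 as [|n _ IH]; [apply incl_refl|].
  eapply incl_tran; [exact IH|apply chain_S].
Qed.

Definition Th (A : form) : Prop := exists n, prv T (chain n) A.

Lemma Th_prv A : prv T [] A -> Th A.
Proof. intros H; exists O. apply prv_weaken with []; [exact H|]. intros ? []. Qed.

Lemma Th_chain n A : In A (chain n) -> Th A.
Proof. intros H; exists n. now apply prv_hyp. Qed.

Lemma Th_join A B (C : form) :
  (forall G, prv T G A -> prv T G B -> prv T G C) -> Th A -> Th B -> Th C.
Proof.
  intros K [m HA] [n HB]. exists (Nat.max m n). apply K.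
  - eapply prv_weaken; [exact HA|apply chain_incl; lia].
  - eapply prv_weaken; [exact HB|apply chain_incl; lia].
Qed.

Lemma Th_impE A B : Th (Imp A B) -> Th A -> Th B.
Proof. apply Th_join. intros G. apply prv_impE. Qed.

Lemma Th_Bot : ~ Th Bot.
Proof. intros [n H]. exact (proj2_sig (Henkin_chain n) H). Qed.

Lemma Th_decide A : Th A \/ Th (Neg A).
Proof.
  destruct (form_enum_surj A) as [n <-].
  destruct (chain_S n) as [_ [[H|H] _]]; [left|right]; eapply Th_chain, H.
Qed.

Lemma Th_Imp A B : Th (Imp A B) <-> (Th A -> Th B).
Proof.
  split; [apply Th_impE|]. intros H. destruct (Th_decide A) as [HA|[n HA]].
  - destruct (H HA) as [n HB]. exists n. apply prv_impI.
    eapply prv_weaken; [exact HB|apply incl_tl, incl_refl].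
  - exists n. apply prv_impI, prv_raa. apply prv_impE with A.
    + eapply prv_weaken; [exact HA|]. apply incl_tl, incl_tl, incl_refl.
    + apply prv_hyp; simpl; auto.
Qed.

(** Turns derivability into membership at the very stage that treats the formula, which is where its
    witness is added. *)
Lemma Th_witness A : Th (Neg A) -> exists n,
  form_enum n = Neg A /\ In (Neg A) (chain (S n)).
Proof.
  intros H. destruct (form_enum_surj (Neg A)) as [n E]. exists n; split; auto.
  destruct (chain_S n) as [_ [[K|K] _]]; rewrite E in K; [exact K|].
  destruct Th_Bot. eapply Th_impE; [eapply Th_chain, K|exact H].
Qed.

Lemma Th_AllN A : Th (AllN A) <-> forall t, Th (instN t A).
Proof.
  split.
  - intros [n H] t. exists n. now apply prv_allNE.
  - intros H. destruct (Th_decide (AllN A)) as [|N]; [assumption|].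
    destruct (Th_witness _ N) as [n [E I]].
    destruct (chain_S n) as [_ [_ [W _]]]. rewrite <- E in I.
    destruct (W A E I) as [t Ht]. destruct Th_Bot.
    eapply Th_impE; [eapply Th_chain, Ht|apply H].
Qed.

Lemma Th_AllS A : Th (AllS A) <-> forall Y, Th (instS Y A).
Proof.
  split.
  - intros [n H] t. exists n. now apply prv_allSE.
  - intros H. destruct (Th_decide (AllS A)) as [|N]; [assumption|].
    destruct (Th_witness _ N) as [n [E I]].
    destruct (chain_S n) as [_ [_ [_ W]]]. rewrite <- E in I.
    destruct (W A E I) as [t Ht]. destruct Th_Bot.
    eapply Th_impE; [eapply Th_chain, Ht|apply H].
Qed.

Lemma Th_refl t : Th (Eq t t).
Proof. exists O. apply prv_refl. Qed.

Lemma Th_leibniz A s t : Th (Eq s t) -> Th (instN s A) -> Th (instN t A).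
Proof. apply Th_join. intros G. apply prv_leibniz. Qed.

Lemma Th_sym s t : Th (Eq s t) -> Th (Eq t s).
Proof.
  intros H. apply (Th_leibniz (Eq (Var O) (tshift s))) in H.
  - unfold instN in H; simpl in H.
    now rewrite tsubst_scons_tshift, tsubst_id in H.
  - unfold instN; simpl. rewrite tsubst_scons_tshift, tsubst_id. apply Th_refl.
Qed.

Lemma Th_trans s t u : Th (Eq s t) -> Th (Eq t u) -> Th (Eq s u).
Proof.
  intros H K. apply (Th_leibniz (Eq (tshift s) (Var O))) in K;
  unfold instN in *; simpl in *;
  now rewrite tsubst_scons_tshift, tsubst_id in *.
Qed.

(* A choice of one term in each class of provably equal terms, so that equality
   is interpreted by Leibniz equality without forming a quotient. *)
Definition nf (t : term) : term :=
  epsilon (inhabits Zero) (fun s => Th (Eq t s)).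

Lemma Th_nf t : Th (Eq t (nf t)).
Proof. unfold nf. apply epsilon_spec. exists t. apply Th_refl. Qed.

Lemma nf_eq s t : nf s = nf t <-> Th (Eq s t).
Proof.
  split; intros H.
  - eapply Th_trans; [apply Th_nf|]. rewrite H. apply Th_sym, Th_nf.
  (* Provably equal terms have extensionally equal classes, and [epsilon] selects the same member
     from equal predicates. *)
  - unfold nf. f_equal. apply functional_extensionality; intros u.
    apply propositional_extensionality; split; intros K.
    + eapply Th_trans; [apply Th_sym, H|exact K].
    + eapply Th_trans; [exact H|exact K].
Qed.

Lemma nf_idem t : nf (nf t) = nf t.
Proof. apply nf_eq, Th_sym, Th_nf. Qed.

Definition elt := {t : term | nf t = t}.

Definition class (t : term) : elt := exist _ (nf t) (nf_idem t).

Definition rep (d : elt) : term := proj1_sig d.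

Lemma rep_class t : rep (class t) = nf t.
Proof. reflexivity. Qed.

Lemma elt_ext d d' : rep d = rep d' -> d = d'.
Proof.
  destruct d as [t Ht], d' as [t' Ht']; simpl; intros <-. f_equal.
  apply proof_irrelevance.
Qed.

Lemma class_eq s t : class s = class t <-> Th (Eq s t).
Proof.
  rewrite <- nf_eq. split; intros H; [exact (f_equal rep H)|now apply elt_ext].
Qed.

Lemma class_rep d : class (rep d) = d.
Proof. apply elt_ext. exact (proj2_sig d). Qed.

Lemma Th_congr A s t sigma : Th (Eq s t) ->
  Th (subst (scons s sigma) (fun X => X) A) ->
  Th (subst (scons t sigma) (fun X => X) A).
Proof.
  assert (E : forall t, subst (scons t sigma) (fun X => X) A =
                        instN t (subst (upN sigma) (fun X => X) A)).
  { intros u. unfold instN. rewrite subst_comp. f_equal.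
    apply functional_extensionality; intros [|n]; simpl; [reflexivity|].
    now rewrite tsubst_scons_tshift, tsubst_id. }
  rewrite !E. apply Th_leibniz.
Qed.

Lemma Th_congr2 A s s' t t' : Th (Eq s s') -> Th (Eq t t') ->
  Th (subst (scons s (scons t Var)) (fun X => X) A) ->
  Th (subst (scons s' (scons t' Var)) (fun X => X) A).
Proof.
  intros Hs Ht H. apply (Th_congr _ _ _ _ Hs) in H.
  (* Exchanging variables 0 and 1 brings the second argument to the front, where the Leibniz rule
     acts. *)
  assert (E : forall u, subst (scons s' (scons u Var)) (fun X => X) A =
    subst (scons u (scons s' Var)) (fun X => X)
      (subst (scons (Var 1) (scons (Var 0) (fun n => Var (S (S n)))))
         (fun X => X) A)).
  { intros u. rewrite subst_comp. f_equal.
    now apply functional_extensionality; intros [|[|n]]. }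
  rewrite E in *. now apply (Th_congr _ _ _ _ Ht).
Qed.

Lemma tsubst_scons2_tshift2 s t u :
  tsubst (scons s (scons t Var)) (tshift (tshift u)) = u.
Proof. now rewrite !tsubst_scons_tshift, tsubst_id. Qed.

Lemma Th_Add s s' t t' :
  Th (Eq s s') -> Th (Eq t t') -> Th (Eq (Add s t) (Add s' t')).
Proof.
  intros Hs Ht.
  pose proof (Th_congr2 (Eq (tshift (tshift (Add s t))) (Add (Var 0) (Var 1)))
                s s' t t' Hs Ht) as K.
  cbn [subst] in K. rewrite !tsubst_scons2_tshift2 in K. apply K, Th_refl.
Qed.

Lemma Th_Mul s s' t t' :
  Th (Eq s s') -> Th (Eq t t') -> Th (Eq (Mul s t) (Mul s' t')).
Proof.
  intros Hs Ht.
  pose proof (Th_congr2 (Eq (tshift (tshift (Mul s t))) (Mul (Var 0) (Var 1)))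
                s s' t t' Hs Ht) as K.
  cbn [subst] in K. rewrite !tsubst_scons2_tshift2 in K. apply K, Th_refl.
Qed.

(** Set variables denote themselves. Two of them may have the same members, which is harmless
    because the language has no equality of sets. *)
Definition Henkin_model : structure := {|
  num := elt;
  sets := nat;
  zero := class Zero;
  one := class One;
  add d d' := class (Add (rep d) (rep d'));
  mul d d' := class (Mul (rep d) (rep d'));
  lt d d' := Th (Lt (rep d) (rep d'));
  mem d X := Th (Mem (rep d) X) |}.

Lemma eval_Henkin e t :
  eval Henkin_model e t = class (tsubst (fun n => rep (e n)) t).
Proof.
  induction t; simpl.
  - now rewrite class_rep.
  - reflexivity.
  - reflexivity.
  - rewrite IHt1, IHt2. apply class_eq, Th_Add; apply Th_sym, Th_nf.
  - rewrite IHt1, IHt2. apply class_eq, Th_Mul; apply Th_sym, Th_nf.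
Qed.

Lemma sat_Henkin A : forall e rho,
  sat Henkin_model e rho A <-> Th (subst (fun n => rep (e n)) rho A).
Proof.
  induction A; intros e rho; simpl.
  - split; [intros []|apply Th_Bot].
  - rewrite IHA1, IHA2, Th_Imp. reflexivity.
  - rewrite !eval_Henkin. apply class_eq.
  - rewrite !eval_Henkin, !rep_class.
    split; apply (Th_congr2 (Lt (Var 0) (Var 1)));
    solve [apply Th_nf | apply Th_sym, Th_nf].
  - rewrite !eval_Henkin, !rep_class.
    split; apply (Th_leibniz (Mem (Var 0) (rho X)));
    solve [apply Th_nf | apply Th_sym, Th_nf].
  - rewrite Th_AllN. split.
    + intros H t. specialize (H (class t)). rewrite IHA in H.
      replace (fun n => rep (scons (class t) e n))
        with (scons (nf t) (fun n => rep (e n))) in H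
        by now apply functional_extensionality; intros [|n].
      (* The model only ranges over normal forms, so the instance at [nf t] is transported to
         [t]. *)
      apply (Th_leibniz _ (nf t) t); [apply Th_sym, Th_nf|].
      unfold instN. rewrite subst_comp.
      erewrite subst_ext; [exact H| |auto].
      intros [|n] _; simpl; [reflexivity|].
      now rewrite tsubst_scons_tshift, tsubst_id.
    + intros H d. rewrite IHA. specialize (H (rep d)).
      unfold instN in H. rewrite subst_comp in H.
      erewrite subst_ext; [exact H| |auto].
      intros [|n] _; simpl; [reflexivity|].
      now rewrite tsubst_scons_tshift, tsubst_id.
  - rewrite Th_AllS.
    assert (E : forall Y, instS Y (subst (fun n => rep (e n)) (upS rho) A) =
                          subst (fun n => rep (e n)) (scons Y rho) A).
    { intros Y. unfold instS. rewrite subst_comp. apply subst_ext.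
      - intros n _. apply tsubst_id.
      - now intros [|n] _. }
    split; intros H Y; specialize (H Y); [rewrite E|rewrite E in H];
    now apply IHA.
Qed.

Lemma models_Henkin : models Henkin_model T.
Proof.
  intros A HA e s. apply sat_Henkin, Th_prv, prv_ax, T_subst, HA.
Qed.

End Henkin.

Theorem completeness T A : subst_closed T ->
  (forall sigma rho, subst sigma rho A = A) ->
  (forall M, models M T -> forall e s, sat M e s A) -> provable T A.
Proof.
  intros HT HA H. apply NNPP. intros N.
  assert (C : consistent T [Neg A]).
  { intros K. apply N. now apply prv_raa. }
  (* The number environment is arbitrary: by [HA], substituting its representatives does not change
     [A]. *)
  pose proof (H _ (models_Henkin T HT _ C) (fun _ => class _ _ _ _ Zero)
                (fun n => n)) as K.
  apply sat_Henkin in K. rewrite HA in K.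
  apply (Th_Bot T HT _ C). eapply Th_impE; [|exact K].
  apply (Th_chain T HT _ C 0). now left.
Qed.

(** * Definable predicates *)

Lemma eval_subst M e sigma t :
  eval M e (tsubst sigma t) = eval M (fun n => eval M e (sigma n)) t.
Proof. induction t; simpl; congruence. Qed.

Lemma eval_tshift M d e t : eval M (scons d e) (tshift t) = eval M e t.
Proof. unfold tshift; rewrite eval_subst; reflexivity. Qed.

Lemma sat_subst M A : forall e s sigma rho,
  sat M e s (subst sigma rho A) <->
  sat M (fun n => eval M e (sigma n)) (fun X => s (rho X)) A.
Proof.
  induction A; intros e v sigma rho; simpl; rewrite ?eval_subst;
    try reflexivity.
  - now rewrite IHA1, IHA2.
  - enough (E : forall d, (fun n => eval M (scons d e) (upN sigma n)) =
      scons d (fun n => eval M e (sigma n))).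
    { split; intros H d; specialize (H d); rewrite ?IHA, ?E in *; auto. }
    intros d. apply functional_extensionality; intros [|n]; simpl; auto.
    apply eval_tshift.
  - enough (E : forall d, (fun n => scons d v (upS rho n)) =
      scons d (fun n => v (rho n))).
    { split; intros H d; specialize (H d); rewrite ?IHA, ?E in *; auto. }
    intros d. now apply functional_extensionality; intros [|n].
Qed.

(* Equivalent to [sat], but unfolds conjunctions and existential quantifiers
   to those of Rocq. *)
Fixpoint holds (M : structure) (e : nat -> num M) (s : nat -> sets M) (A : form)
  : Prop :=
  match A with
  | Bot => False
  | Imp (AllN (Imp A Bot)) Bot => exists d, holds M (scons d e) s A
  | Imp (AllS (Imp A Bot)) Bot => exists Z, holds M e (scons Z s) A
  | Imp (Imp A (Imp B Bot)) Bot => holds M e s A /\ holds M e s B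
  | Imp A B => holds M e s A -> holds M e s B
  | Eq t u => eval M e t = eval M e u
  | Lt t u => lt M (eval M e t) (eval M e u)
  | Mem t X => mem M (eval M e t) (s X)
  | AllN A => forall d, holds M (scons d e) s A
  | AllS A => forall Z, holds M e (scons Z s) A
  end.

Fixpoint fsize (A : form) : nat :=
  match A with
  | Imp A B => S (fsize A + fsize B)
  | AllN A | AllS A => S (fsize A)
  | _ => O
  end.

(** The nested patterns of [holds] recurse below immediate subformulas, hence induction on size. *)
Lemma holds_iff_sat M A e s : holds M e s A <-> sat M e s A.
Proof.
  remember (fsize A) as n eqn:En. revert A e s En.
  induction n as [n IH] using lt_wf_ind. intros A e s ->.
  assert (IH' : forall B, fsize B < fsize A ->
            forall e s, holds M e s B <-> sat M e s B) by eauto.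
  clear IH. rename IH' into IH.
  destruct A as [|A B|t u|t u|t X|A|A]; cbn [holds sat]; try reflexivity.
  - assert (Dflt : (holds M e s A -> holds M e s B) <->
                   (sat M e s A -> sat M e s B)).
    { rewrite !IH by (simpl; lia). reflexivity. }
    destruct B; try solve [repeat first [exact Dflt
      | match goal with |- context [match ?A with _ => _ end] => destruct A end]].
    destruct A as [|A B| | | |A|A]; try exact Dflt.
    + destruct B as [|B C| | | | | ]; try exact Dflt.
      destruct C; try exact Dflt.
      rewrite !IH by (simpl; lia). cbn [sat]. tauto.
    + destruct A as [|A B| | | | | ]; try exact Dflt.
      destruct B; try exact Dflt.
      split.
      * intros [d H] K. apply (K d), IH; [simpl; lia|exact H].
      * intros H. apply NNPP. intros N. apply H. intros d K. apply N.
        exists d. apply IH; [simpl; lia|exact K].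
    + destruct A as [|A B| | | | | ]; try exact Dflt.
      destruct B; try exact Dflt.
      split.
      * intros [d H] K. apply (K d), IH; [simpl; lia|exact H].
      * intros H. apply NNPP. intros N. apply H. intros d K. apply N.
        exists d. apply IH; [simpl; lia|exact K].
  - split; intros H d; apply IH; auto.
  - split; intros H d; apply IH; auto.
Qed.

Lemma sat_And M e s A B : sat M e s (And A B) <-> sat M e s A /\ sat M e s B.
Proof. cbn [sat And Neg]. tauto. Qed.

Lemma sat_Iff M e s A B :
  sat M e s (Iff A B) <-> (sat M e s A <-> sat M e s B).
Proof. unfold Iff. rewrite sat_And. reflexivity. Qed.

Lemma sat_ExN M e s A : sat M e s (ExN A) <-> exists d, sat M (scons d e) s A.
Proof.
  cbn [sat ExN Neg]. split.
  - intros N. apply NNPP. intros C. apply N. intros d K. eauto.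
  - intros [d K] N. exact (N d K).
Qed.

Lemma sat_ExS M e s A : sat M e s (ExS A) <-> exists Z, sat M e (scons Z s) A.
Proof.
  cbn [sat ExS Neg]. split.
  - intros N. apply NNPP. intros C. apply N. intros d K. eauto.
  - intros [d K] N. exact (N d K).
Qed.

(** Merges the assignments of two formulas into one, after renaming their variables to even and odd
    indices. *)
Definition interleave {T : Type} (f g : nat -> T) (n : nat) : T :=
  if Nat.even n then f (Nat.div2 n) else g (Nat.div2 n).

Lemma interleave_even {T : Type} (f g : nat -> T) n :
  interleave f g (2 * n) = f n.
Proof. unfold interleave. now rewrite Nat.even_even, Nat.div2_even. Qed.

Lemma interleave_odd {T : Type} (f g : nat -> T) n :
  interleave f g (S (2 * n)) = g n.
Proof.
  unfold interleave. rewrite Nat.div2_succ_double.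
  now rewrite <- Nat.add_1_r, Nat.even_odd.
Qed.

Lemma eq_iff (P Q : Prop) : P = Q -> (P <-> Q).
Proof. now intros ->. Qed.

Section Definability.

Context (M : structure) (HM : models M RCA0) (Z0 : sets M).

(* A number variable of a formula stands either for a parameter or for an
   argument, given by its position in the environment. *)
Definition assign (p : nat -> num M + nat) (e : nat -> num M) (n : nat) : num M :=
  match p n with inl d => d | inr i => e i end.

Definition DefTerm (f : (nat -> num M) -> num M) : Prop :=
  exists t p, forall e, f e = eval M (assign p e) t.

(** With the closure lemmas below, complexity can be checked on Rocq predicates without writing the
    defining formulas. *)
Definition Delta0 (P : (nat -> num M) -> Prop) : Prop :=
  exists A p s, Sigma00 A /\ forall e, P e <-> sat M (assign p e) s A.

Lemma DefTerm_join f g : DefTerm f -> DefTerm g -> exists t u p, forall e,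
  f e = eval M (assign p e) t /\ g e = eval M (assign p e) u.
Proof.
  intros [t [p Hf]] [u [q Hg]].
  exists (tsubst (fun n => Var (2 * n)) t), (tsubst (fun n => Var (S (2 * n))) u).
  exists (interleave p q). intros e. rewrite !eval_subst, Hf, Hg.
  split; f_equal; apply functional_extensionality; intros n; cbn [eval];
    unfold assign; now rewrite ?interleave_even, ?interleave_odd.
Qed.

Lemma Delta0_join P Q : Delta0 P -> Delta0 Q -> exists A B p s,
  Sigma00 A /\ Sigma00 B /\
  forall e, (P e <-> sat M (assign p e) s A) /\ (Q e <-> sat M (assign p e) s B).
Proof.
  intros [A [p [s [HA HP]]]] [B [q [s' [HB HQ]]]].
  exists (subst (fun n => Var (2 * n)) (fun n => 2 * n) A).
  exists (subst (fun n => Var (S (2 * n))) (fun n => S (2 * n)) B).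
  exists (interleave p q), (interleave s s').
  split; [now apply Sigma00_subst|]. split; [now apply Sigma00_subst|].
  intros e. rewrite HP, HQ, !sat_subst.
  split; apply eq_iff; f_equal; apply functional_extensionality; intros n;
    cbn [eval]; unfold assign; now rewrite ?interleave_even, ?interleave_odd.
Qed.

Lemma DefTerm_var n : DefTerm (fun e => e n).
Proof. now exists (Var 0), (fun _ => inr n). Qed.

Lemma DefTerm_const c : DefTerm (fun _ => c).
Proof. now exists (Var 0), (fun _ => inl c). Qed.

Lemma DefTerm_add f g :
  DefTerm f -> DefTerm g -> DefTerm (fun e => add M (f e) (g e)).
Proof.
  intros Hf Hg. destruct (DefTerm_join _ _ Hf Hg) as [t [u [p H]]].
  exists (Add t u), p. intros e; simpl. now destruct (H e) as [-> ->].
Qed.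

Lemma DefTerm_mul f g :
  DefTerm f -> DefTerm g -> DefTerm (fun e => mul M (f e) (g e)).
Proof.
  intros Hf Hg. destruct (DefTerm_join _ _ Hf Hg) as [t [u [p H]]].
  exists (Mul t u), p. intros e; simpl. now destruct (H e) as [-> ->].
Qed.

Lemma Delta0_iff P Q : (forall e, P e <-> Q e) -> Delta0 P -> Delta0 Q.
Proof.
  intros H [A [p [s [HA HP]]]]. exists A, p, s. split; auto.
  intros e. now rewrite <- H.
Qed.

Lemma Delta0_eq f g :
  DefTerm f -> DefTerm g -> Delta0 (fun e => f e = g e).
Proof.
  intros Hf Hg. destruct (DefTerm_join _ _ Hf Hg) as [t [u [p H]]].
  exists (Eq t u), p, (fun _ => Z0). split; [constructor|].
  intros e; simpl. now destruct (H e) as [-> ->].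
Qed.

Lemma Delta0_lt f g :
  DefTerm f -> DefTerm g -> Delta0 (fun e => lt M (f e) (g e)).
Proof.
  intros Hf Hg. destruct (DefTerm_join _ _ Hf Hg) as [t [u [p H]]].
  exists (Lt t u), p, (fun _ => Z0). split; [constructor|].
  intros e; simpl. now destruct (H e) as [-> ->].
Qed.

Lemma Delta0_mem f Z : DefTerm f -> Delta0 (fun e => mem M (f e) Z).
Proof.
  intros [t [p H]]. exists (Mem t 0), p, (fun _ => Z). split; [constructor|].
  intros e; simpl. now rewrite H.
Qed.

Lemma Delta0_False : Delta0 (fun _ => False).
Proof.
  exists Bot, (fun _ => inr 0), (fun _ => Z0). now split; [constructor|].
Qed.

Lemma Delta0_imp P Q : Delta0 P -> Delta0 Q -> Delta0 (fun e => P e -> Q e).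
Proof.
  intros HP HQ. destruct (Delta0_join _ _ HP HQ) as [A [B [p [s [HA [HB H]]]]]].
  exists (Imp A B), p, s. split; [now constructor|].
  intros e; simpl. now destruct (H e) as [-> ->].
Qed.

Lemma Delta0_not P : Delta0 P -> Delta0 (fun e => ~ P e).
Proof. intros HP. exact (Delta0_imp _ _ HP Delta0_False). Qed.

Lemma Delta0_and P Q : Delta0 P -> Delta0 Q -> Delta0 (fun e => P e /\ Q e).
Proof.
  intros HP HQ. apply Delta0_iff with (fun e => ~ (P e -> ~ Q e)).
  - intros e; tauto.
  - auto using Delta0_not, Delta0_imp.
Qed.

Lemma Delta0_or P Q : Delta0 P -> Delta0 Q -> Delta0 (fun e => P e \/ Q e).
Proof.
  intros HP HQ. apply Delta0_iff with (fun e => ~ P e -> Q e).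
  - intros e; tauto.
  - auto using Delta0_not, Delta0_imp.
Qed.

Lemma Delta0_equiv P Q : Delta0 P -> Delta0 Q -> Delta0 (fun e => P e <-> Q e).
Proof. intros HP HQ. apply Delta0_and; now apply Delta0_imp. Qed.

Lemma Delta0_ball f (B : num M -> (nat -> num M) -> Prop) : DefTerm f ->
  Delta0 (fun e => B (e 0) (fun n => e (S n))) ->
  Delta0 (fun e => forall i, lt M i (f e) -> B i e).
Proof.
  intros [t [q Hf]] [A [p [s [HA HB]]]].
  (* Argument 0 of the body becomes the bound variable through [sigma], and the other arguments move
     down by one. The value [zero M] is a placeholder in the table. *)
  pose (p' n := match p n with
                | inr (S i) => inr i | inr O => inl (zero M) | inl d => inl d
                end).
  pose (sigma n := match p n with inr O => Var 0 | _ => Var (S (2 * n)) end).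
  exists (AllN (Imp (Lt (Var 0) (tshift (tsubst (fun n => Var (S (2 * n))) t)))
                 (subst sigma (fun X => X) A))).
  exists (interleave p' q), s.
  split; [constructor; now apply Sigma00_subst|].
  intros e. cbn [sat eval]. setoid_rewrite eval_tshift.
  rewrite eval_subst, Hf.
  replace (fun n => eval M (assign (interleave p' q) e) (Var (S (2 * n))))
    with (assign q e)
    by (apply functional_extensionality; intros n; cbn [eval];
        unfold assign; now rewrite interleave_odd).
  enough (E : forall i, B i e <-> sat M (scons i (assign (interleave p' q) e)) s
                                    (subst sigma (fun X => X) A)).
  { split; intros H i Hi; apply E; auto. }
  intros i. rewrite sat_subst.
  replace (fun n => eval M (scons i (assign (interleave p' q) e)) (sigma n))
    with (assign p (scons i e)); [apply (HB (scons i e))|].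
  apply functional_extensionality; intros n. unfold sigma.
  pose proof (interleave_even p' q n) as E.
  unfold assign, p' in *. destruct (p n) as [d|[|j]]; cbn [eval scons];
    now rewrite ?E.
Qed.

Lemma Delta0_bex f (B : num M -> (nat -> num M) -> Prop) : DefTerm f ->
  Delta0 (fun e => B (e 0) (fun n => e (S n))) ->
  Delta0 (fun e => exists i, lt M i (f e) /\ B i e).
Proof.
  intros Hf HB. apply Delta0_iff with (fun e => ~ forall i, lt M i (f e) -> ~ B i e).
  - intros e; split.
    + intros H. apply NNPP. intros N. apply H. intros i Hi Bi. eauto.
    + intros [i [Hi Bi]] H. eapply H; eauto.
  - apply Delta0_not.
    apply (Delta0_ball f (fun i e => ~ B i e)); auto using Delta0_not.
Qed.

Lemma Delta0_shift (P : num M -> Prop) :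
  Delta0 (fun e => P (e 0)) -> Delta0 (fun e => P (e 1)).
Proof.
  intros [A [p [s [HA H]]]].
  exists A, (fun n => match p n with inl d => inl d | inr i => inr (S i) end), s.
  split; auto. intros e. rewrite (H (fun n => e (S n))).
  apply eq_iff. f_equal. apply functional_extensionality; intros i.
  unfold assign. now destruct (p i).
Qed.

(** Brings the two arguments to de Bruijn indices 0 and 1 and turns everything else into parameters.
    [sigma] and [e] depend on [p] alone, so that both formulas of a comprehension instance share one
    environment. *)
Lemma Delta0_binary p : exists sigma e,
  forall (Q : num M -> num M -> Prop) A s,
  (forall e, Q (e 1) (e 0) <-> sat M (assign p e) s A) ->
  forall n a, Q n a <-> sat M (scons a (scons n e)) s (subst sigma (fun X => X) A).
Proof.
  exists (fun n => match p n with
                   | inr 0 => Var 0 | inr 1 => Var 1 | _ => Var (S (S n))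
                   end).
  exists (assign p (fun _ => zero M)). intros Q A s H n a. rewrite sat_subst.
  rewrite (H (scons a (scons n (fun _ => zero M)))). unfold assign.
  match goal with |- sat M ?f _ _ <-> sat M ?g _ _ => replace g with f end;
    [reflexivity|].
  apply functional_extensionality; intros m.
  destruct (p m) as [d|[|[|i]]] eqn:E; simpl; now rewrite ?E.
Qed.

(** * Induction and comprehension for definable predicates *)

Theorem induction_Sigma1 (Q : num M -> num M -> Prop) :
  Delta0 (fun e => Q (e 1) (e 0)) ->
  (exists a, Q (zero M) a) ->
  (forall n, (exists a, Q n a) -> exists a, Q (add M n (one M)) a) ->
  forall n, exists a, Q n a.
Proof.
  intros [A [p [s [HA H]]]] Q0 QS.
  destruct (Delta0_binary p) as [sigma [e E]]. specialize (E Q A s H). clear H.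
  set (A' := subst sigma (fun X => X) A) in E.
  assert (HA' : Sigma00 A') by now apply Sigma00_subst.
  clearbody A'. clear A HA.
  pose proof (HM _ (Sigma01_induction (ExN A') (Sigma01_ex _ HA')) e s) as I.
  assert (X : forall n, sat M (scons n e) s (ExN A') <-> exists a, Q n a).
  { intros n. rewrite sat_ExN. split; intros [a K]; exists a; now apply E. }
  enough (C : sat M e s (AllN (ExN A'))) by (intros n; apply X, C).
  refine (I _). apply sat_And. split.
  - unfold instN. apply sat_subst.
    replace (fun n => eval M e (scons Zero Var n)) with (scons (zero M) e)
      by now apply functional_extensionality; intros [|n].
    now apply X.
  - intros n K. unfold inst_succ. apply sat_subst.
    match goal with |- sat M ?f _ _ =>
      replace f with (scons (add M n (one M)) e)
        by now apply functional_extensionality; intros [|m] end.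
    apply X, QS, X, K.
Qed.

Theorem comprehension_Delta1 (Q R : num M -> num M -> Prop) :
  Delta0 (fun e => Q (e 1) (e 0)) -> Delta0 (fun e => R (e 1) (e 0)) ->
  (forall n, (exists a, Q n a) <-> (forall a, R n a)) ->
  exists Z, forall n, mem M n Z <-> exists a, Q n a.
Proof.
  intros HQ HR QR.
  destruct (Delta0_join _ _ HQ HR) as [A [B [p [s [HA [HB H]]]]]].
  destruct (Delta0_binary p) as [sigma [e E]].
  assert (EQ := E Q A s (fun e => proj1 (H e))).
  assert (ER := E R B s (fun e => proj2 (H e))). clear E H.
  set (A' := subst sigma (fun X => X) A) in EQ.
  set (B' := subst sigma (fun X => X) B) in ER.
  assert (HA' : Sigma00 A') by now apply Sigma00_subst.
  assert (HB' : Sigma00 B') by now apply Sigma00_subst.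
  pose proof (HM _ (Delta01_comprehension (ExN A') (AllN B')
    (Sigma01_ex _ HA') (Pi01_all _ HB')) e s) as C.
  assert (X : sat M e s (AllN (Iff (ExN A') (AllN B')))).
  { intros n. rewrite sat_Iff, sat_ExN. cbn [sat]. split.
    - intros [a K] d. apply ER, QR. exists a. now apply EQ.
    - intros K. destruct (proj2 (QR n)) as [a Ka].
      + intros a. apply ER, K.
      + exists a. now apply EQ. }
  specialize (C X). apply sat_ExS in C. destruct C as [Z HZ].
  exists Z. intros n. specialize (HZ n).
  apply sat_Iff in HZ. cbn [sat eval scons] in HZ. rewrite HZ.
  unfold shiftS. rewrite sat_subst. rewrite sat_ExN. split; intros [a K];
  exists a; apply EQ, K.
Qed.

End Definability.

(** * Arithmetic *)

Declare Scope num_scope.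

Section Arithmetic.

Context (M : structure) (HM : models M RCA0) (Z0 : sets M).

Local Notation "0" := (zero M) : num_scope.
Local Notation "1" := (one M) : num_scope.
Local Notation "x + y" := (add M x y) : num_scope.
Local Notation "x * y" := (mul M x y) : num_scope.
Local Notation "x < y" := (lt M x y) : num_scope.
Local Notation "x <= y" := (lt M x (add M y (one M))) : num_scope.
Local Notation "x ∈ Z" := (mem M x Z) : num_scope.
Local Open Scope num_scope.

Ltac def_term := first
  [ exact (DefTerm_var M _) | exact (DefTerm_const M _)
  | apply (DefTerm_add M); def_term | apply (DefTerm_mul M); def_term ].

(** Follows the shape of the predicate; [unf] is rerun at every level to expose the defined
    predicates met there. *)
Ltac delta0_with unf := cbv beta; unf; first
  [ apply (Delta0_ball M); [def_term | delta0_with unf]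
  | apply (Delta0_bex M Z0); [def_term | delta0_with unf]
  | apply (Delta0_equiv M Z0); delta0_with unf
  | apply (Delta0_and M Z0); delta0_with unf
  | apply (Delta0_or M Z0); delta0_with unf
  | apply (Delta0_not M Z0); delta0_with unf
  | apply (Delta0_imp M); delta0_with unf
  | apply (Delta0_eq M Z0); def_term
  | apply (Delta0_lt M Z0); def_term
  | apply (Delta0_mem M); def_term ].

Ltac delta0 := delta0_with idtac.

Lemma induction_Delta0 (P : num M -> Prop) :
  Delta0 M (fun e => P (e O)) ->
  P 0 -> (forall n, P n -> P (n + 1)) -> forall n, P n.
Proof.
  intros HP H0 HS n.
  destruct (induction_Sigma1 M HM (fun n a => P n)) with (n := n); auto.
  - now apply Delta0_shift.
  - now exists 0.
  - intros m [_ K]. exists 0. auto.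
Qed.

Ltac num_induction z :=
  revert z;
  match goal with |- forall z, @?P z =>
    apply (induction_Delta0 P); [delta0|cbv beta|cbv beta]
  end.

(** * The ordered semiring of numbers *)

Lemma succ_neq0 x : x + 1 <> 0.
Proof. exact (HM _ succ_neq_zero (fun _ => 0) (fun _ => Z0) x). Qed.

Lemma succ_injective x y : x + 1 = y + 1 -> x = y.
Proof. exact (HM _ succ_inj (fun _ => 0) (fun _ => Z0) x y). Qed.

Lemma addn0 x : x + 0 = x.
Proof. exact (HM _ add_zero (fun _ => 0) (fun _ => Z0) x). Qed.

Lemma addnS x y : x + (y + 1) = x + y + 1.
Proof. exact (HM _ add_succ (fun _ => 0) (fun _ => Z0) x y). Qed.

Lemma muln0 x : x * 0 = 0.
Proof. exact (HM _ mul_zero (fun _ => 0) (fun _ => Z0) x). Qed.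

Lemma mulnS x y : x * (y + 1) = x * y + x.
Proof. exact (HM _ mul_succ (fun _ => 0) (fun _ => Z0) x y). Qed.

Lemma ltn0 x : ~ x < 0.
Proof. exact (HM _ not_lt_zero (fun _ => 0) (fun _ => Z0) x). Qed.

Lemma ltnS x y : x < y + 1 <-> x < y \/ x = y.
Proof.
  pose proof (HM _ lt_succ (fun _ => 0) (fun _ => Z0) x y) as H.
  apply sat_Iff in H. cbn in H. tauto.
Qed.

Lemma add0n x : 0 + x = x.
Proof.
  num_induction x; [apply addn0|].
  intros n IH. now rewrite addnS, IH.
Qed.

Lemma addSn x y : x + 1 + y = x + y + 1.
Proof.
  num_induction y; [now rewrite !addn0|].
  intros n IH. now rewrite !addnS, IH.
Qed.

Lemma addnC x y : x + y = y + x.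
Proof.
  num_induction y; [now rewrite addn0, add0n|].
  intros n IH. now rewrite addnS, addSn, IH.
Qed.

Lemma addnA x y z : x + (y + z) = x + y + z.
Proof.
  num_induction z; [now rewrite !addn0|].
  intros n IH. now rewrite !addnS, IH.
Qed.

Lemma mul0n x : 0 * x = 0.
Proof.
  num_induction x; [apply muln0|].
  intros n IH. now rewrite mulnS, IH, addn0.
Qed.

Lemma mulSn x y : (x + 1) * y = x * y + y.
Proof.
  num_induction y; [now rewrite !muln0, addn0|].
  intros n IH. rewrite !mulnS, IH, !addnS. f_equal.
  now rewrite <- !addnA, (addnC n x).
Qed.

Lemma mulnC x y : x * y = y * x.
Proof.
  num_induction y; [now rewrite muln0, mul0n|].
  intros n IH. now rewrite mulnS, mulSn, IH.
Qed.

Lemma mul1n x : 1 * x = x.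
Proof. rewrite <- (add0n 1), mulSn, mul0n. apply add0n. Qed.

Lemma mulnDl x y z : (x + y) * z = x * z + y * z.
Proof.
  num_induction z; [now rewrite !muln0, addn0|].
  intros n IH. rewrite !mulnS, IH, <- !addnA. f_equal.
  rewrite !addnA. f_equal. apply addnC.
Qed.

Lemma mulnA x y z : x * (y * z) = x * y * z.
Proof.
  num_induction z; [now rewrite !muln0|].
  intros n IH. rewrite !mulnS, <- IH.
  now rewrite mulnC, mulnDl, (mulnC (y * n) x), (mulnC y x).
Qed.

Lemma num_semi_ring : semi_ring_theory 0 1 (add M) (mul M) eq.
Proof.
  constructor; [apply add0n|apply addnC|apply addnA|apply mul1n|apply mul0n
    |apply mulnC|apply mulnA|apply mulnDl].
Qed.

Add Ring num_ring : num_semi_ring.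

Lemma addIn x y z : x + z = y + z -> x = y.
Proof.
  num_induction z; [now rewrite !addn0|].
  intros n IH. rewrite !addnS. intros H. now apply IH, succ_injective.
Qed.

Lemma num_cases x : x = 0 \/ exists y, x = y + 1.
Proof.
  (* The bound on [y] makes the induction formula Delta_0. *)
  enough (H : x = 0 \/ exists y, y < x /\ x = y + 1).
  { destruct H as [H|[y [_ H]]]; eauto. }
  num_induction x; [now left|].
  intros n _. right. exists n. split; [|easy]. apply ltnS; auto.
Qed.

Lemma ltn_addr x c : x < x + c + 1.
Proof.
  num_induction c; [ |].
  - rewrite addn0. apply ltnS; auto.
  - intros n IH. rewrite addnS. apply ltnS; auto.
Qed.

Lemma ltn_iff x y : x < y <-> exists c, y = x + c + 1.
Proof.
  split; [|intros [c ->]; apply ltn_addr].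
  enough (H : x < y -> exists c, c < y /\ y = x + c + 1).
  { intros K. destruct (H K) as [c [_ E]]; eauto. }
  num_induction y; [now intros H; apply ltn0 in H|].
  intros n IH H. apply ltnS in H. destruct H as [H| ->].
  - destruct (IH H) as [c [_ ->]]. exists (c + 1). split; [|ring].
    replace (x + c + 1 + 1) with (c + 1 + x + 1) by ring. apply ltn_addr.
  - exists 0. split; [|ring]. rewrite <- (add0n n). apply ltn_addr.
Qed.

Lemma add_eq0 x y : x + y = 0 -> x = 0 /\ y = 0.
Proof.
  destruct (num_cases y) as [->|[z ->]].
  - rewrite addn0; auto.
  - rewrite addnS. intros H. now apply succ_neq0 in H.
Qed.

Lemma neq_addS x y : x <> x + y + 1.
Proof.
  intros H. apply (succ_neq0 y), (addIn _ _ x).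
  replace (y + 1 + x) with (x + y + 1) by ring. now rewrite add0n.
Qed.

Lemma ltn_trans x y z : x < y -> y < z -> x < z.
Proof.
  rewrite !ltn_iff. intros [c ->] [d ->]. exists (c + d + 1). ring.
Qed.

Lemma leq_ltn_trans x y z : x <= y -> y < z -> x < z.
Proof. rewrite ltnS. intros [H| ->]; eauto using ltn_trans. Qed.

Lemma ltn_leq_trans x y z : x < y -> y <= z -> x < z.
Proof. rewrite ltnS. intros H [K| <-]; eauto using ltn_trans. Qed.

Lemma leq_iff x y : x <= y <-> exists c, y = x + c.
Proof.
  rewrite ltn_iff. split; intros [c H]; exists c; [now apply succ_injective|].
  now rewrite H.
Qed.

Lemma ltn_cases x y : x < y \/ x = y \/ y < x.
Proof.
  num_induction y; [ |].
  - destruct (num_cases x) as [->|[z ->]]; auto. right; right.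
    rewrite <- (add0n z). apply ltn_addr.
  - intros n [H|[H|H]].
    + left. apply ltnS; auto.
    + left. apply ltnS; auto.
    + right. rewrite ltn_iff in H. destruct H as [c ->].
      destruct (num_cases c) as [->|[d ->]].
      * left. ring.
      * right. apply ltn_iff. exists d. ring.
Qed.

Lemma leq_or_gtn x y : x <= y \/ y < x.
Proof. rewrite ltnS. pose proof (ltn_cases x y). tauto. Qed.

Lemma ltn0S x : 0 < x + 1.
Proof. rewrite <- (add0n x). apply ltn_addr. Qed.

Lemma leqnn x : x <= x.
Proof. apply ltnS; auto. Qed.

Lemma leq_addr x y : x <= x + y.
Proof. apply leq_iff; eauto. Qed.

Lemma leq_addl x y : x <= y + x.
Proof. rewrite (addnC y x). apply leq_addr. Qed.

Lemma comprehension_Delta0 (P : num M -> Prop) :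
  Delta0 M (fun e => P (e O)) -> exists Z, forall n, n ∈ Z <-> P n.
Proof.
  intros HP.
  apply (Delta0_shift M P) in HP.
  destruct (comprehension_Delta1 M HM (fun n _ => P n) (fun n _ => P n) HP HP)
    as [Z HZ].
  - intros n; split; [now intros [_ K]|]. intros K. exists 0. exact (K 0).
  - exists Z. intros n. rewrite HZ. split; [now intros [_ K]|]. now exists 0.
Qed.

Lemma least_number_Delta0 (P : num M -> Prop) :
  Delta0 M (fun e => P (e O)) -> (exists n, P n) ->
  exists n, P n /\ forall m, m < n -> ~ P m.
Proof.
  intros HP [n Hn].
  (* Membership in a set is a form that [delta0] recognizes, unlike the abstract [P]. *)
  destruct (comprehension_Delta0 P HP) as [Z HZ].
  apply NNPP. intros N.
  enough (H : forall n m, m < n -> ~ m ∈ Z).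
  { apply (H (n + 1) n); [apply leqnn|now apply HZ]. }
  apply (induction_Delta0 (fun n => forall m, m < n -> ~ m ∈ Z)); [delta0| |].
  - intros m Hm. now apply ltn0 in Hm.
  - intros k IH m Hm. apply ltnS in Hm. destruct Hm as [Hm| ->]; auto.
    intros K. apply N. exists k. split; [now apply HZ|].
    intros m Hm. rewrite <- HZ. auto.
Qed.

(** * Injectivity and bounds of the pairing *)

Definition npair (x y : num M) : num M := (x + y) * (x + y) + x.

Lemma npair_lt x y x' y' : x + y < x' + y' -> npair x y <> npair x' y'.
Proof.
  unfold npair. rewrite ltn_iff. intros [c ->] H.
  (* The second argument is the difference of the two codes minus one, computed from x' + y' = x + y
     + c + 1. *)
  apply (neq_addS ((x + y) * (x + y) + x)
           (c * c + (1 + 1) * ((x + y) * c) + x + (1 + 1) * y + (1 + 1) * c + x')).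
  rewrite H at 1. ring.
Qed.

Lemma npair_inj x y x' y' : npair x y = npair x' y' -> x = x' /\ y = y'.
Proof.
  intros H. destruct (ltn_cases (x + y) (x' + y')) as [K|[K|K]].
  - now destruct (npair_lt _ _ _ _ K).
  - unfold npair in H. rewrite K, (addnC _ x), (addnC _ x') in H.
    apply addIn in H. subst x'. split; auto.
    apply (addIn _ _ x). now rewrite (addnC y), (addnC y').
  - now destruct (npair_lt _ _ _ _ K).
Qed.

Lemma leq_npair_l x y : x <= npair x y.
Proof. apply leq_addl. Qed.

Lemma leq_npair_r x y : y <= npair x y.
Proof.
  unfold npair. destruct (num_cases y) as [->|[z ->]].
  - apply ltn0S.
  - apply leq_iff.
    exists (x * x + z * z + (1 + 1) * (x * z) + (1 + 1 + 1) * x + z). ring.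
Qed.

(** ** Codes of finite sets *)

(** The bound on the quotient keeps divisibility Delta_0; [dvd_iff] removes it for nonzero
    divisors. *)
Definition dvd (d a : num M) : Prop := exists q, q < a + 1 /\ q * d = a.

Lemma dvd_iff d a : dvd (d + 1) a <-> exists q, q * (d + 1) = a.
Proof.
  split; intros [q H]; [now exists q|].
  exists q. split; auto. apply leq_iff. exists (q * d). rewrite <- H. ring.
Qed.

Lemma dvd_mulr d a b : dvd (d + 1) a -> dvd (d + 1) (a * b).
Proof.
  rewrite !dvd_iff. intros [q <-]. exists (q * b). ring.
Qed.

Lemma dvd_add_cancel d a b : dvd (d + 1) (a + b) -> dvd (d + 1) a -> dvd (d + 1) b.
Proof.
  rewrite !dvd_iff. intros [q H] [r <-]. destruct (leq_or_gtn r q) as [K|K].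
  - apply leq_iff in K. destruct K as [c ->]. exists c.
    apply (addIn _ _ (r * (d + 1))). rewrite (addnC b), <- H. ring.
  - apply ltn_iff in K. destruct K as [c ->]. exists 0.
    assert (E : (c + 1) * (d + 1) + b = 0).
    { apply (addIn _ _ (q * (d + 1))). rewrite add0n. rewrite H at 2. ring. }
    apply add_eq0 in E. destruct E as [_ ->]. ring.
Qed.

(** Replaces the factorial: only the existence of a multiple is carried through the induction, which
    is thereby Sigma_1. *)
Lemma common_multiple n : exists b, 0 < b /\ forall t, t < n -> dvd (t + 1) b.
Proof.
  revert n. apply (induction_Sigma1 M HM
    (fun n b => 0 < b /\ forall t, t < n -> dvd (t + 1) b)).
  - delta0_with ltac:(unfold dvd).
  - exists 1. split; [rewrite <- (add0n 1); apply ltn0S|].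
    intros t Ht. now apply ltn0 in Ht.
  - intros n [b [Hb H]]. exists (b * (n + 1)). split.
    + destruct (num_cases b) as [->|[c ->]]; [now apply ltn0 in Hb|].
      replace ((c + 1) * (n + 1)) with (c * n + c + n + 1) by ring. apply ltn0S.
    + intros t Ht. apply ltnS in Ht. destruct Ht as [Ht| ->].
      * now apply dvd_mulr, H.
      * apply dvd_iff. now exists b.
Qed.

(* Gödel's moduli: pairwise coprime for i < n when b is divisible by all positive
   numbers up to n. *)
Definition modulus (b i : num M) : num M := (i + 1) * b + 1.

(** For j = i + c + 1 one has (j + 1) * m_i = (i + 1) * m_j + (c + 1), where m_i is [modulus b i].
    Hence m_i divides a * (c + 1), and so a * b * (i + 1) because c + 1 divides b; this is a * m_i
    without its summand a. The case j < i is symmetric, rearranged to avoid subtraction. *)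
Lemma modulus_coprime n b i j a :
  (forall t, t < n -> dvd (t + 1) b) -> i < n -> j < n -> i <> j ->
  dvd (modulus b i) (a * modulus b j) -> dvd (modulus b i) a.
Proof.
  intros Hb Hi Hj Hij H.
  assert (K : exists c, c < n /\ dvd (modulus b i) (a * (c + 1))).
  { destruct (ltn_cases i j) as [L|[L|L]]; [|now destruct Hij|].
    - pose proof L as L'. apply ltn_iff in L. destruct L as [c E].
      exists c. split.
      + apply ltn_trans with j; auto. rewrite E.
        replace (i + c + 1) with (c + i + 1) by ring. apply ltn_addr.
      + apply dvd_add_cancel with (a * (i + 1) * modulus b j).
        * apply dvd_iff. exists (a * (j + 1)). rewrite E. unfold modulus. ring.
        * replace (a * (i + 1) * modulus b j) with (a * modulus b j * (i + 1))
            by ring.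
          now apply dvd_mulr.
    - pose proof L as L'. apply ltn_iff in L. destruct L as [c E].
      exists c. split.
      + apply ltn_trans with i; auto. rewrite E.
        replace (j + c + 1) with (c + j + 1) by ring. apply ltn_addr.
      + apply dvd_add_cancel with (a * (j + 1) * modulus b i).
        * replace (a * (j + 1) * modulus b i + a * (c + 1))
            with (a * modulus b j * (i + 1)) by (rewrite E; unfold modulus; ring).
          now apply dvd_mulr.
        * apply dvd_iff. now exists (a * (j + 1)). }
  destruct K as [c [Hc K]]. destruct (Hb c Hc) as [q [_ E]].
  apply dvd_add_cancel with (a * b * (i + 1)).
  - apply dvd_iff. exists a. unfold modulus. ring.
  - replace (a * b * (i + 1)) with (a * (c + 1) * (q * (i + 1)))
      by (rewrite <- E; ring).
    now apply dvd_mulr.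
Qed.

(** The code [a] is the product of the moduli of the elements of [Z] below [n]. It is built by
    induction on [j], with [b] fixed in advance so that all moduli involved are coprime. *)
Lemma finite_set_code Z n :
  exists a b, forall i, i < n -> (dvd (modulus b i) a <-> i ∈ Z).
Proof.
  destruct (common_multiple n) as [b [b_pos Hb]].
  assert (H : forall j, exists a, forall i, i < n ->
    (dvd (modulus b i) a <-> i < j /\ i ∈ Z)).
  { apply (induction_Sigma1 M HM (fun j a => forall i, i < n ->
      (dvd (modulus b i) a <-> i < j /\ i ∈ Z))).
    - delta0_with ltac:(unfold dvd, modulus).
    (* The empty product: since b > 0, every modulus exceeds 1 and does not divide it. *)
    - exists 1. intros i _. split; [|now intros [K _]; apply ltn0 in K].
      intros K. exfalso. apply dvd_iff in K. destruct K as [q K].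
      destruct (num_cases b) as [->|[c ->]]; [now apply ltn0 in b_pos|].
      destruct (num_cases q) as [->|[r ->]].
      + rewrite mul0n in K. apply (succ_neq0 0). now rewrite add0n.
      + apply (neq_addS 1 (r * (i + 1) * (c + 1) + r + i * c + i + c)).
        rewrite <- K at 1. ring.
    - intros j [a H]. destruct (classic (j < n /\ j ∈ Z)) as [[Hj HZ]|N].
      + exists (a * modulus b j). intros i Hi.
        destruct (classic (i = j)) as [->|Hij].
        * split; [intros _; split; [apply leqnn|easy]|].
          intros _. apply dvd_iff. now exists a.
        * assert (E : i < j + 1 <-> i < j) by (rewrite ltnS; tauto).
          rewrite E, <- (H i Hi). split; [|apply dvd_mulr].
          apply modulus_coprime with n; auto.
      + exists a. intros i Hi. rewrite (H i Hi), ltnS. split; [tauto|].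
        intros [[K| ->] L]; tauto. }
  destruct (H n) as [a Ha]. exists a, b. intros i Hi. rewrite (Ha i Hi). tauto.
Qed.

(** Bounding the components by [c] keeps membership Delta_0. The component [n] cuts off the range in
    which the moduli are meaningful and makes elements smaller than their code. *)
Definition in_code (p c : num M) : Prop :=
  exists a, a < c + 1 /\ exists b, b < c + 1 /\ exists n, n < c + 1 /\
    c = npair (npair a b) n /\ p < n /\ dvd (modulus b p) a.

Lemma in_code_npair p a b n :
  in_code p (npair (npair a b) n) <-> p < n /\ dvd (modulus b p) a.
Proof.
  split.
  - intros [a' [_ [b' [_ [n' [_ [E K]]]]]]].
    apply npair_inj in E. destruct E as [E ->].
    apply npair_inj in E. destruct E as [-> ->]. exact K.
  - intros K. exists a. split.
    { apply leq_ltn_trans with (npair a b); apply leq_npair_l. }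
    exists b. split.
    { apply leq_ltn_trans with (npair a b);
      [apply leq_npair_r|apply leq_npair_l]. }
    exists n. split; [apply leq_npair_r|]. now split.
Qed.

Lemma in_code_ltn p c : in_code p c -> p < c.
Proof.
  intros [a [_ [b [_ [n [_ [-> [H _]]]]]]]].
  apply ltn_leq_trans with n; auto using leq_npair_r.
Qed.

Lemma empty_code : exists c, forall p, ~ in_code p c.
Proof.
  exists (npair (npair 0 0) 0). intros p. rewrite in_code_npair.
  intros [H _]. exact (ltn0 _ H).
Qed.

(** The old [b] need not suit larger elements, so the enlarged set is formed by comprehension and
    coded afresh. *)
Lemma adjoin_code c q : exists c', forall p, in_code p c' <-> in_code p c \/ p = q.
Proof.
  destruct (comprehension_Delta0 (fun p => in_code p c \/ p = q)) as [Z HZ].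
  { delta0_with ltac:(unfold in_code, npair, dvd, modulus). }
  destruct (finite_set_code Z (c + q + 1)) as [a [b H]].
  exists (npair (npair a b) (c + q + 1)). intros p. rewrite in_code_npair.
  split.
  - intros [Hp K]. now apply HZ, H.
  - intros K. assert (Hp : p < c + q + 1).
    { destruct K as [K| ->]; [|apply leq_addl].
      apply ltn_trans with c; [now apply in_code_ltn|apply ltn_addr]. }
    split; auto. now apply H, HZ.
Qed.

(** * Discrete subspaces *)

Section Space.

Context (X U k : sets M).

Definition nbhd (x n : num M) : Prop := npair x n ∈ U.

Definition value (x m n p : num M) : Prop := npair (npair (npair x m) n) p ∈ k.

Context (nbhd_sub : forall n x, nbhd x n -> x ∈ X)
  (nbhd_cover : forall x, x ∈ X -> exists n, nbhd x n)
  (value_total : forall x m n, x ∈ X -> exists p, value x m n p)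
  (value_nbhd : forall x m n p, value x m n p -> nbhd x m -> nbhd x n ->
     nbhd x p /\ forall z, nbhd z p -> nbhd z m /\ nbhd z n)
  (X_infinite : forall b, exists x, b < x /\ x ∈ X)
  (X_Hausdorff : forall x y, x ∈ X -> y ∈ X -> x <> y ->
     exists m n, nbhd x m /\ nbhd y n /\ ~ exists z, nbhd z m /\ nbhd z n).

Ltac delta0_nbhd :=
  delta0_with ltac:(unfold in_code, dvd, modulus, nbhd, value, npair).

(** * Neighbourhoods satisfying finitely many requirements *)

Lemma nbhd_inter x m n : nbhd x m -> nbhd x n ->
  exists p, nbhd x p /\ forall z, nbhd z p -> nbhd z m /\ nbhd z n.
Proof.
  intros Hm Hn. destruct (value_total x m n) as [p Hp]; eauto.
Qed.

Lemma nbhd_separate x y : x ∈ X -> y ∈ X -> x <> y ->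
  exists n, nbhd x n /\ ~ nbhd y n.
Proof.
  intros Hx Hy N. destruct (X_Hausdorff x y Hx Hy N) as [m [n [Hm [Hn D]]]].
  exists m. split; eauto.
Qed.

(* [c] codes a set of pairs (i, w) in which every pair with i > 0 is justified by
   a pair (i - 1, v), where U_w = U_v, or U_w is contained in both U_v and U_(i-1)
   if the latter contains x. *)
Definition descending (x c : num M) : Prop :=
  forall p, p < c -> in_code p c ->
    exists i, i < p + 1 /\ exists w, w < p + 1 /\ p = npair i w /\ nbhd x w /\
      (i = 0 \/ exists j, j < i /\ exists v, v < c /\ i = j + 1 /\
        in_code (npair j v) c /\
        ((~ nbhd x j /\ w = v) \/ (nbhd x j /\ value x v j w))).

(** Sigma_1 induction on the length: justifications mention values of [k] and no inclusions, so the
    matrix is Delta_0. Passing to m + 1 adjoins one pair, whose second component is the previous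
    neighbourhood or its refinement by [k]. *)
Lemma descending_exists x : x ∈ X -> forall m, exists c,
  (exists w, w < c /\ in_code (npair m w) c) /\ descending x c.
Proof.
  intros Hx.
  apply (induction_Sigma1 M HM (fun m c =>
    (exists w, w < c /\ in_code (npair m w) c) /\ descending x c)).
  - unfold descending. delta0_nbhd.
  - destruct (nbhd_cover x Hx) as [w Hw], empty_code as [c0 H0].
    destruct (adjoin_code c0 (npair 0 w)) as [c Hc]. exists c.
    assert (I : in_code (npair 0 w) c) by (apply Hc; auto).
    split.
    + exists w. split; auto.
      apply leq_ltn_trans with (npair 0 w); auto using leq_npair_r, in_code_ltn.
    + intros p _ Hp. apply Hc in Hp. destruct Hp as [Hp| ->]; [now apply H0 in Hp|].
      exists 0. split; [apply leq_npair_l|]. exists w.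
      split; [apply leq_npair_r|]. auto.
  - intros m [c0 [[v [_ Hv]] D]].
    assert (W : exists w, nbhd x w /\
      ((~ nbhd x m /\ w = v) \/ (nbhd x m /\ value x v m w))).
    { destruct (D _ (in_code_ltn _ _ Hv) Hv) as [i [_ [w [_ [E [Hw _]]]]]].
      apply npair_inj in E. destruct E as [-> ->].
      destruct (classic (nbhd x i)) as [Hi|Hi]; [|now exists w; auto].
      destruct (value_total x w i Hx) as [p Hp]. exists p.
      split; [now apply (value_nbhd _ _ _ _ Hp)|auto]. }
    destruct W as [w [Hw Hvw]].
    destruct (adjoin_code c0 (npair (m + 1) w)) as [c Hc]. exists c.
    (* Old justifications persist in [c], but the bound on their witness must be re-established for
       the new code. *)
    assert (bound : forall i u, in_code (npair i u) c -> u < c).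
    { intros i u Hu.
      apply leq_ltn_trans with (npair i u); auto using leq_npair_r, in_code_ltn. }
    assert (I : in_code (npair (m + 1) w) c) by (apply Hc; auto).
    split; [eauto|].
    intros p _ Hp. apply Hc in Hp. destruct Hp as [Hp| ->].
    + destruct (D p (in_code_ltn _ _ Hp) Hp)
        as [i [Hi [u [Hu [E [Hxu J]]]]]].
      exists i. split; auto. exists u. repeat (split; auto).
      destruct J as [J|[j [Hj [t [_ [E' [It J]]]]]]]; auto.
      right. exists j. split; auto. exists t.
      assert (in_code (npair j t) c) by (apply Hc; auto).
      repeat split; eauto.
    + exists (m + 1). split; [apply leq_npair_l|]. exists w.
      split; [apply leq_npair_r|]. repeat (split; auto).
      right. exists m. split; [apply leqnn|]. exists v.
      assert (in_code (npair m v) c) by (apply Hc; auto).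
      repeat split; eauto.
Qed.

Definition agree (x z n : num M) : Prop :=
  forall j, j < n -> nbhd x j -> nbhd z j.

(** Once [c] and [z] are fixed, descending along the code is a Delta_0 induction. A code may hold
    several pairs with the same first component, so the induction treats all of them at once. *)
Lemma nbhd_agree x : x ∈ X -> forall n, exists w,
  nbhd x w /\ forall z, nbhd z w -> agree x z n.
Proof.
  intros Hx n. destruct (descending_exists x Hx n) as [c [[w [_ Hw]] D]].
  exists w. split.
  { destruct (D _ (in_code_ltn _ _ Hw) Hw) as [i [_ [u [_ [E [Hu _]]]]]].
    apply npair_inj in E. now destruct E as [_ ->]. }
  intros z Hz.
  enough (H : forall i u, u < c -> in_code (npair i u) c -> nbhd z u ->
            agree x z i).
  { apply (H n w); auto.
    apply leq_ltn_trans with (npair n w); auto using leq_npair_r, in_code_ltn. }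
  clear w Hw Hz.
  apply (induction_Delta0 (fun i => forall u, u < c -> in_code (npair i u) c ->
    nbhd z u -> agree x z i)).
  - unfold agree. delta0_nbhd.
  - intros u _ _ _ j Hj. now apply ltn0 in Hj.
  - intros i IH u Hu Iu Hzu.
    destruct (D _ (in_code_ltn _ _ Iu) Iu) as [i' [_ [u' [_ [E [Hxu J]]]]]].
    apply npair_inj in E. destruct E as [<- <-].
    destruct J as [J|[j [_ [v [Hv [E [Iv J]]]]]]]; [now apply succ_neq0 in J|].
    apply succ_injective in E. subst j.
    assert (K : nbhd z v /\ (nbhd x i -> nbhd z i)).
    { destruct J as [[N ->]|[Hi J]]; [tauto|].
      assert (Hxv : nbhd x v).
      { destruct (D _ (in_code_ltn _ _ Iv) Iv) as [i' [_ [u' [_ [E [H _]]]]]].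
        apply npair_inj in E. now destruct E as [_ ->]. }
      destruct (value_nbhd _ _ _ _ J Hxv Hi) as [_ K].
      split; intros; now apply K. }
    intros j Hj. apply ltnS in Hj. destruct Hj as [Hj| ->]; [|apply K].
    now apply (IH v Hv Iv).
Qed.

(** Sigma_1 because only points below [t] are concerned. If [t] is a point other than [y], the step
    intersects U_w with a neighbourhood of [y] that misses [t]. *)
Lemma nbhd_avoid y : y ∈ X -> forall t, exists w,
  nbhd y w /\ forall z, z < t -> nbhd z w -> z = y.
Proof.
  intros Hy. apply (induction_Sigma1 M HM (fun t w =>
    nbhd y w /\ forall z, z < t -> nbhd z w -> z = y)).
  - delta0_nbhd.
  - destruct (nbhd_cover y Hy) as [w Hw]. exists w. split; auto.
    intros z Hz. now apply ltn0 in Hz.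
  - intros t [w [Hw H]].
    assert (S : exists v, nbhd y v /\ (nbhd t v -> t = y)).
    { destruct (classic (t ∈ X)) as [Ht|Ht].
      - destruct (classic (t = y)) as [E|E]; [eauto|].
        destruct (nbhd_separate y t) as [v [Hv N]]; auto.
        exists v. tauto.
      - exists w. split; auto. intros K. now apply nbhd_sub in K. }
    destruct S as [v [Hv St]].
    destruct (nbhd_inter y w v Hw Hv) as [p [Hp K]].
    exists p. split; auto. intros z Hz Hzp. apply ltnS in Hz.
    destruct (K z Hzp). destruct Hz as [Hz| ->]; auto.
Qed.

(** * Records converging to a limit point *)

Section AccumulationPoint.

Context (x : num M) (Hx : x ∈ X)
  (x_limit : forall n, nbhd x n -> exists z, nbhd z n /\ z <> x).

(* The graph of the function g of the header. *)
Definition omits (z n : num M) : Prop :=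
  nbhd x n /\ ~ nbhd z n /\ agree x z n.

Lemma omits_exists z : z ∈ X -> z <> x -> exists n, omits z n.
Proof.
  intros Hz N.
  destruct (least_number_Delta0 (fun n => nbhd x n /\ ~ nbhd z n))
    as [n [[Hn Hzn] L]].
  - delta0_nbhd.
  - now apply nbhd_separate; auto.
  - exists n. repeat split; auto. intros j Hj Hxj. apply NNPP. intros K.
    apply (L j Hj). auto.
Qed.

Lemma omits_unique z m n : omits z m -> omits z n -> m = n.
Proof.
  intros [Hm [Nm Am]] [Hn [Nn An]].
  destruct (ltn_cases m n) as [L|[L|L]]; auto; exfalso; auto.
Qed.

Definition punctured (z : num M) : Prop := z ∈ X /\ z <> x.

(** The inner existential is g(y) < n in bounded form, so for n = g(z) this says that z is a
    record. *)
Definition record (z n : num M) : Prop :=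
  forall y, y < z -> punctured y -> exists i, i < n /\ nbhd x i /\ ~ nbhd y i.

(** Delta_1 comprehension: as g(z) exists and is unique, being a record at some value of g(z) and at
    every value of it are equivalent. *)
Lemma records_exist : exists Y, forall z,
  z ∈ Y <-> punctured z /\ exists n, omits z n /\ record z n.
Proof.
  destruct (comprehension_Delta1 M HM
    (fun z n => punctured z /\ omits z n /\ record z n)
    (fun z n => punctured z /\ (omits z n -> record z n))) as [Y HY].
  - unfold punctured, omits, record, agree. delta0_nbhd.
  - unfold punctured, omits, record, agree. delta0_nbhd.
  - intros z. split.
    + intros [m [Hz [Hm R]]] n. split; auto. intros Hn.
      now rewrite (omits_unique z n m Hn Hm).
    (* Any instance yields [punctured z], which stands under the universal quantifier. *)
    + intros H. destruct (H 0) as [[Hz N] _].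
      destruct (omits_exists z Hz N) as [n Hn]. exists n.
      split; [now split|]. split; auto. now apply H.
  - exists Y. intros z. rewrite HY. firstorder.
Qed.

(** Take the least z other than x that agrees with x below n: every smaller y fails to agree, so
    g(y) < n <= g(z). *)
Lemma far_record Y n :
  (forall z, z ∈ Y <-> punctured z /\ exists n, omits z n /\ record z n) ->
  exists z, z ∈ Y /\ agree x z n /\ record z n.
Proof.
  intros HY. destruct (nbhd_agree x Hx n) as [w [Hw A]].
  destruct (least_number_Delta0 (fun z => punctured z /\ agree x z n))
    as [z [[[Hz N] Az] L]].
  - unfold punctured, agree. delta0_nbhd.
  - destruct (x_limit w Hw) as [z [Hz N]]. exists z.
    split; [split|]; eauto.
  - assert (R : record z n).
    { intros y Hy Py. apply NNPP. intros K. apply (L y Hy). split; auto.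
      intros i Hi Hxi. apply NNPP. intros Ny. apply K; eauto. }
    exists z. split; [|now split]. apply HY. split; [now split|].
    destruct (omits_exists z Hz N) as [m Hm]. exists m. split; auto.
    assert (Lm : n <= m).
    { destruct (leq_or_gtn n m) as [|C]; auto.
      exfalso. apply (proj1 (proj2 Hm)), Az; auto. apply Hm. }
    intros y Hy Py. destruct (R y Hy Py) as [i [Hi K]]. exists i.
    split; auto. now apply ltn_leq_trans with n.
Qed.

(** Bounds g on an initial segment. Hence a point that agrees with x below [n] lies beyond the
    segment, which makes the set of records infinite. *)
Lemma omits_bound b : exists n, forall z, z < b -> punctured z ->
  exists i, i < n /\ nbhd x i /\ ~ nbhd z i.
Proof.
  revert b. apply (induction_Sigma1 M HM (fun b n =>
    forall z, z < b -> punctured z -> exists i, i < n /\ nbhd x i /\ ~ nbhd z i)).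
  - unfold punctured. delta0_nbhd.
  - exists 0. intros z Hz. now apply ltn0 in Hz.
  - intros b [n H].
    assert (E : exists m, punctured b -> nbhd x m /\ ~ nbhd b m).
    { destruct (classic (punctured b)) as [[Hb N]|C]; [|now exists 0].
      destruct (nbhd_separate x b Hx Hb) as [m Hm]; auto. exists m. auto. }
    destruct E as [m Hm]. exists (n + m + 1). intros z Hz P.
    apply ltnS in Hz. destruct Hz as [Hz| ->].
    + destruct (H z Hz P) as [i [Hi K]]. exists i. split; auto.
      apply ltn_trans with n; auto. apply ltn_addr.
    + exists m. split; auto. apply leq_addl.
Qed.

Lemma discrete_of_limit_point : exists Y,
  (forall z, z ∈ Y -> z ∈ X) /\ (forall b, exists z, b < z /\ z ∈ Y) /\
  (forall y, y ∈ Y -> exists n, nbhd y n /\ forall z, z ∈ Y -> nbhd z n -> z = y).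
Proof.
  destruct records_exist as [Y HY]. exists Y. split; [|split].
  - intros z Hz. apply HY in Hz. apply Hz.
  - intros b. destruct (omits_bound (b + 1)) as [n Hn].
    destruct (far_record Y n HY) as [z [Hz [A _]]]. exists z. split; auto.
    destruct (leq_or_gtn z b) as [C|]; auto.
    apply HY in Hz. destruct (Hn z C (proj1 Hz)) as [i [Hi [Hxi N]]].
    now destruct N; apply A.
  - intros y Hy. apply HY in Hy. destruct Hy as [[HyX Ny] _].
    destruct (X_Hausdorff y x HyX Hx Ny) as [m [n [Hm [Hn D]]]].
    destruct (far_record Y (n + 1) HY) as [t [Ht [A _]]].
    (* U_w isolates [y] from the points up to [t]; points of [Y] beyond [t] will be excluded by
       U_m. *)
    destruct (nbhd_avoid y HyX (t + 1)) as [w [Hw S]].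
    destruct (nbhd_inter y m w Hm Hw) as [p [Hp K]].
    exists p. split; auto. intros z Hz Hzp. destruct (K z Hzp) as [Hzm Hzw].
    destruct (leq_or_gtn z t) as [C|C]; [now apply S|].
    (* Here l = g(z). Since z is a record beyond t, some i < l has x but not t in U_i, and n < i
       because t agrees with x up to n. So z agrees with x at n and lies in both U_m and U_n. *)
    exfalso. apply HY in Hz. destruct Hz as [_ [l [[_ [_ Al]] R]]].
    apply HY in Ht. destruct (R t C (proj1 Ht)) as [i [Hi [Hxi N]]].
    apply D. exists z. split; auto. apply Al; auto.
    apply ltn_trans with i; auto.
    destruct (leq_or_gtn i n) as [B|]; auto. now destruct N; apply A.
Qed.

End AccumulationPoint.

Theorem infinite_discrete_subset : exists Y,
  (forall z, z ∈ Y -> z ∈ X) /\ (forall b, exists z, b < z /\ z ∈ Y) /\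
  (forall y, y ∈ Y -> exists n, nbhd y n /\ forall z, z ∈ Y -> nbhd z n -> z = y).
Proof.
  destruct (classic (exists x, x ∈ X /\
    forall n, nbhd x n -> exists z, nbhd z n /\ z <> x)) as [[x [Hx L]]|N].
  - exact (discrete_of_limit_point x Hx L).
  - exists X. split; [auto|split; [exact X_infinite|]].
    intros y Hy. apply NNPP. intros C. apply N. exists y. split; auto.
    intros n Hn. apply NNPP. intros D. apply C. exists n. split; auto.
    intros z _ Hz. apply NNPP. intros E. apply D. eauto.
Qed.

(** Components are bounded by the code of their pair, so both sets exist by Delta_0
    comprehension. *)
Lemma subspace_exists Y : exists V l,
  (forall n z, npair z n ∈ V <-> npair z n ∈ U /\ z ∈ Y) /\
  (forall q, q ∈ l <-> q ∈ k /\ exists x m n p, x ∈ Y /\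
     q = npair (npair (npair x m) n) p).
Proof.
  destruct (comprehension_Delta0 (fun q => q ∈ U /\ exists z, z < q + 1 /\
    exists n, n < q + 1 /\ q = npair z n /\ z ∈ Y)) as [V HV]; [delta0_nbhd|].
  destruct (comprehension_Delta0 (fun q => q ∈ k /\ exists x, x < q + 1 /\
    exists m, m < q + 1 /\ exists n, n < q + 1 /\ exists p, p < q + 1 /\ x ∈ Y /\
    q = npair (npair (npair x m) n) p)) as [l Hl]; [delta0_nbhd|].
  exists V, l. split.
  - intros n z. rewrite HV. split.
    + intros [H [z' [_ [n' [_ [E Hz]]]]]]. apply npair_inj in E.
      now destruct E as [-> _].
    + intros [H Hz]. split; auto. exists z. split; [apply leq_npair_l|].
      exists n. split; [apply leq_npair_r|]. auto.
  - intros q. rewrite Hl. split.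
    + intros [H [x [_ [m [_ [n [_ [p [_ K]]]]]]]]]. split; auto. now exists x, m, n, p.
    + intros [H [x [m [n [p [Hx E]]]]]]. split; auto.
      assert (B1 : npair (npair x m) n <= q) by (rewrite E; apply leq_npair_l).
      assert (B2 : npair x m <= q).
      { apply leq_ltn_trans with (npair (npair x m) n); auto using leq_npair_l. }
      exists x. split.
      { apply leq_ltn_trans with (npair x m); auto using leq_npair_l. }
      exists m. split.
      { apply leq_ltn_trans with (npair x m); auto using leq_npair_r. }
      exists n. split.
      { apply leq_ltn_trans with (npair (npair x m) n); auto using leq_npair_r. }
      exists p. split; [rewrite E; apply leq_npair_r|]. auto.
Qed.

End Space.

End Arithmetic.

(* Set indices: 2, 1, 0 are X, U, k; under the existential quantifiers, 5, 4, 3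
   are X, U, k and 2, 1, 0 are the subspace Y, V, l. *)
Theorem theorem5p2 :
  provable RCA0
    (AllS (AllS (AllS (
       CSC 2 1 0 /\ Infinite 2 /\ Hausdorff 2 1 ==>
       ExS (ExS (ExS (
         Subspace 2 1 0 5 4 3 /\ Infinite 2 /\ Discrete 2 1))))))%form).
Proof.
  apply completeness; [exact RCA0_subst|reflexivity|].
  intros M HM e s. apply holds_iff_sat. intros X U k. cbn.
  intros [[Hsub [Hcov [[_ Htot] Href]]] [Hinf Hhaus]].
  (* The first [X] is the value of [Z0], the default set interpreting variables of formulas that
     mention no set. *)
  destruct (infinite_discrete_subset M HM X X U k) as [Y [YX [Yinf Ydisc]]].
  - intros n x. apply Hsub.
  - exact Hcov.
  - intros x m n Hx. apply (Htot x m n Hx).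
  - intros x m n p Hp Hm Hn. apply (Href x m n p). now repeat split.
  - exact Hinf.
  - intros x y Hx Hy N. apply Hhaus. now repeat split.
  - destruct (subspace_exists M HM X U k Y) as [V [l [HV Hl]]].
    exists Y, V, l. split; [split; [exact YX|split; [exact HV|exact Hl]]|].
    split; [exact Yinf|]. intros y Hy.
    destruct (Ydisc y Hy) as [n [Hn D]]. exists n. intros z. split.
    + intros Hz. apply HV in Hz. now apply D.
    + intros ->. now apply HV.
Qed.
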